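(* Let $A$ be a linear operator on a $2$-dimensional complex Hilbert space. The (generalized) major semi-axis length of the conformal range $\mathrm{DW}^{\mathbb R}(A)$ is $$s^+=\frac12\,\mathrm{arcosh}\frac{U_A+E_A}{\bigl|E_A-|D_A|\bigr|},$$ and half of its (generalized) focal distance is $$s^{\mathrm f}=\frac12\,\mathrm{arcosh}\frac{E_A+|D_A|}{\bigl|E_A-|D_A|\bigr|}.$$ Here $\frac a0=+\infty$ for $a>0$, $\frac00=1$, and $\mathrm{arcosh}(+\infty)=+\infty$.
   Context: Conformal range in the Beltrami–Cayley–Klein (BCK) model (inner product linear in the first variable): $$\mathrm{DW}^{\mathbb R}_{\mathrm{BCK}}(A)=\left\{\left(\frac{2\,\mathrm{Re}\langle \mathbf y,\mathbf x\rangle}{|\mathbf y|^2+|\mathbf x|^2},\frac{|\mathbf y|^2-|\mathbf x|^2}{|\mathbf y|^2+|\mathbf x|^2}\right): \mathbf y=A\mathbf x,\ \mathbf x\ne0\right\}.$$ The BCK model of the asymptotically closed hyperbolic plane is the closed unit disk; interior points are ordinary, boundary points asymptotic. All notions are hyperbolic and may be read in this model. Distance of ordinary points: $\mathrm d(v,w)=\mathrm{arcosh}\frac{1-\langle v,w\rangle}{\sqrt{1-|v|^2}\sqrt{1-|w|^2}}$; an asymptotic point has distance $+\infty$ from any other point. Notation: $D_A=\det A-\frac{(\mathrm{tr}A)^2}4$, $U_A=\frac{\mathrm{tr}A^*A}2-\frac{|\mathrm{tr}A|^2}4$, $E_A=\left(\frac{\mathrm{Im}\,\mathrm{tr}A}2\right)^2+\frac{|D_A|-\mathrm{Re}D_A}2$.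 Generalized major semi-axis length $s^+$: If $A$ has no real eigenvalue, the range is a point ($s^+=0$), an $h$-segment ($s^+$ is half its hyperbolic length), an $h$-disk ($s^+$ is its hyperbolic radius), or a non-degenerate filled ellipse in the open unit disk which is not an $h$-disk (then $s^+$ is the radius of the unique $h$-disk of minimal radius containing it; a diameter of this $h$-disk lies in the range and is the major axis). If $A$ has at least one real eigenvalue, $s^+=+\infty$, except that $s^+=0$ if the range is a single asymptotic point (i.e. if $A$ is a real scalar multiple of the identity). Generalized focal distance $2s^{\mathrm f}$: If $A$ has no real eigenvalue, the range has the form $\{\boldsymbol x:\mathrm d(F_1,\boldsymbol x)+\mathrm d(F_2,\boldsymbol x)\le m\}$ with ordinary points $F_1,F_2$ (the foci) and $m\ge\mathrm d(F_1,F_2)$, and $2s^{\mathrm f}=\mathrm d(F_1,F_2)$. In the other cases asymptotic points of the range count as foci: $2s^{\mathrm f}=+\infty$ if $A$ has a real eigenvalue and the two eigenvalues are different, and $2s^{\mathrm f}=0$ if $A$ has a double real eigenvalue. *)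

(* Defs.v *)
From HB Require Import structures.
From mathcomp Require Import all_boot all_order all_algebra.
From mathcomp Require Import all_classical all_reals all_analysis.
From mathcomp Require Import complex.

Set Implicit Arguments.
Unset Strict Implicit.
Unset Printing Implicit Defensive.

Import Order.TTheory GRing.Theory Num.Theory.

Local Open Scope classical_set_scope.
Local Open Scope ring_scope.
Local Open Scope complex_scope.

Section Arcosh.
Context {R : realType}.
Implicit Types a b x : R.

(* Meaningful for 1 <= x. *)
Definition arcosh x : R := ln (x + Num.sqrt (x ^+ 2 - 1)).

Definition earcosh (x : \bar R) : \bar R :=
  if x is r%:E then (arcosh r)%:E else +oo%E.

(* a / b for 0 <= a and 0 <= b, with a / 0 = +oo for a > 0 and 0 / 0 = 1;
   the division of \bar R has 0 / 0 = 0 instead. *)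
Definition equot a b : \bar R :=
  if b == 0 then (if a == 0 then 1%E else +oo%E) else (a / b)%:E.

End Arcosh.

Section HyperbolicPlane.
Context {R : realType}.
Implicit Types (v w a b c o x F : R * R) (S : set (R * R)) (r s t m : R).

Definition dotp v w : R := v.1 * w.1 + v.2 * w.2.

Definition ordinary v : bool := dotp v v < 1.
Definition asymptotic v : bool := dotp v v == 1.

(* The value outside the closed unit disk is +oo as well (except hdist v v = 0),
   so that the metric sets below, built from ordinary centers and foci with
   finite bounds, contain only ordinary points. *)
Definition hdist v w : \bar R :=
  if ordinary v && ordinary w then
    (arcosh ((1 - dotp v w) /
             (Num.sqrt (1 - dotp v v) * Num.sqrt (1 - dotp w w))))%:E
  else if v == w then 0%E else +oo%E.

(* Hyperbolic lines of the BCK model are the Euclidean chords of the disk. *)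
Definition hsegment a b : set (R * R) :=
  [set x | exists2 t, 0 <= t <= 1 &
     x = ((1 - t) * a.1 + t * b.1, (1 - t) * a.2 + t * b.2)].

Definition hdisk c r : set (R * R) := [set x | (hdist c x <= r%:E)%E].

Definition is_hdisk S : Prop :=
  exists c r, [/\ ordinary c, 0 < r & S = hdisk c r].

(* Non-degenerate filled (Euclidean) ellipse: {x | q (x - o) <= 1} with q a
   positive definite quadratic form. *)
Definition is_filled_ellipse S : Prop :=
  exists (o : R * R) (p q u : R), [/\ 0 < p, 0 < p * u - q ^+ 2 &
    S = [set x | p * (x.1 - o.1) ^+ 2 + 2 * q * (x.1 - o.1) * (x.2 - o.2)
                 + u * (x.2 - o.2) ^+ 2 <= 1]].

Definition min_hdisk S c r : Prop :=
  [/\ ordinary c, S `<=` hdisk c r &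
      forall c' r', ordinary c' -> S `<=` hdisk c' r' ->
        r <= r' /\ (r' = r -> c' = c)].

Definition hdiameter c r a b : Prop :=
  [/\ ordinary a /\ ordinary b, hsegment a b c,
      hdist c a = r%:E & hdist c b = r%:E].

Variant ordinary_semimajor S : R -> Prop :=
| SemimajorPoint c of ordinary c & S = [set c] : ordinary_semimajor S 0
| SemimajorSegment a b s of ordinary a & ordinary b & a != b
    & S = hsegment a b & hdist a b = (2 * s)%:E : ordinary_semimajor S s
| SemimajorDisk c s of ordinary c & 0 < s & S = hdisk c s :
    ordinary_semimajor S s
| SemimajorEllipse c a b s of is_filled_ellipse S
    & S `<=` [set x | ordinary x] & ~ is_hdisk S & min_hdisk S c s
    & hdiameter c s a b & hsegment a b `<=` S : ordinary_semimajor S s.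

End HyperbolicPlane.

Section Operator.
Context {R : realType} {V : vectType R[i]}.
Variable dot : {dot V for Num.conj}.
Implicit Types A B : 'End(V).

(* A vectType matrix acts on row vectors of coordinates, so this is the transpose
   of the usual matrix of A; trace, determinant and characteristic polynomial
   are unaffected. *)
Definition opmx A := passmx.mxof (vbasis {:V}) (vbasis {:V}) A.

Definition optr A : R[i] := \tr (opmx A).
Definition opdet A : R[i] := \det (opmx A).

Definition is_adjoint A B : Prop := forall x y, dot (A x) y = dot x (B y).

Definition adjoint A : 'End(V) := xget 0 [set B | is_adjoint A B].

Lemma is_adjoint_unique A B B' : is_adjoint A B -> is_adjoint A B' -> B = B'.
Proof.
move=> adjB adjB'; apply/lfunP => y; apply/eqP; rewrite -subr_eq0.
rewrite -(dnorm_eq0 dot) linearBr /= -adjB -adjB' subrr.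
exact: eqxx.
Qed.

Let dots (g : 'I_(\dim {:V}) -> V) (z : V) : 'rV[R[i]]_(\dim {:V}) :=
  \row_i dot z (g i).

Let dots_linear g : linear (dots g).
Proof. by move=> k u v; apply/rowP => i; rewrite !mxE linearPl. Qed.

HB.instance Definition _ g :=
  GRing.isLinear.Build R[i] V 'rV[R[i]]_(\dim {:V}) _ (dots g) (dots_linear g).

Lemma adjointP A : is_adjoint A (adjoint A).
Proof.
pose e i := (vbasis {:V})`_i.
have dotC u v : dot u v = Num.conj (dot v u).
  by rewrite hermC expr0 mul1r.
have extl u v : (forall i : 'I_(\dim {:V}), dot u (e i) = dot v (e i)) ->
    forall x, dot u x = dot v x.
  move=> uv x; rewrite (coord_vbasis (memvf x)) !linear_sumr /=.
  by apply: eq_bigr => i _; rewrite !linearZr_LR /= uv.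
pose L : 'Hom(V, 'rV[R[i]]_(\dim {:V})) := linfun (dots e).
pose M : 'Hom(V, 'rV[R[i]]_(\dim {:V})) := linfun (dots (A \o e)).
have kerL : lker L == 0%VS.
  apply/lker0P => u v; rewrite !lfunE /= => /rowP uv.
  apply/eqP; rewrite -subr_eq0 -(dnorm_eq0 dot) linearBl /= subr_eq0.
  by apply/eqP/extl => i; have := uv i; rewrite !mxE.
have limgL : limg L = fullv.
  apply/eqP; rewrite eqEdim subvf /= limg_dim_eq ?(eqP kerL) ?capv0//.
  by rewrite [leqLHS]dimvf; apply: eq_leq; exact: mul1n.
suff: is_adjoint A (L^-1 \o M)%VF by move=> h; apply: (@xgetPex _ _ _ (ex_intro _ _ h)).
move=> x y; rewrite (coord_vbasis (memvf x)) linear_sum !linear_sumlz /=.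
apply: eq_bigr => i _; rewrite linearZ !linearZl_LR /=; congr (_ * _).
rewrite comp_lfunE -/(e i) dotC [RHS]dotC; congr (Num.conj _).
have : L ((L^-1)%VF (M y)) = M y by rewrite limg_lfunVK// limgL memvf.
by rewrite [in LHS]lfunE [in RHS]lfunE => /rowP/(_ i); rewrite !mxE.
Qed.

Definition sqn (x : V) : R := complex.Re (dot x x).

Definition cabs (z : R[i]) : R := complex.Re `|z|.

Definition conformal_range A : set (R * R) :=
  [set p | exists2 x, x != 0 & let y := A x in
     p = (2 * complex.Re (dot y x) / (sqn y + sqn x),
          (sqn y - sqn x) / (sqn y + sqn x))].

Definition D_ A : R[i] := opdet A - optr A ^+ 2 / 4.

Definition U_ A : R :=
  complex.Re (optr (adjoint A \o A)%VF) / 2 - cabs (optr A) ^+ 2 / 4.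

Definition E_ A : R :=
  (complex.Im (optr A) / 2) ^+ 2 + (cabs (D_ A) - complex.Re (D_ A)) / 2.

Definition has_real_eigenvalue A : Prop :=
  exists l : R, passmx.leigenvalue A l%:C.

Definition range_is_asymptotic_point A : Prop :=
  exists2 v, asymptotic v & conformal_range A = [set v].

Variant major_semiaxis A : \bar R -> Prop :=
| MajorOrdinary s of ~ has_real_eigenvalue A
    & ordinary_semimajor (conformal_range A) s : major_semiaxis A s%:E
| MajorAsymptoticPoint of has_real_eigenvalue A
    & range_is_asymptotic_point A : major_semiaxis A 0%E
| MajorAsymptotic of has_real_eigenvalue A
    & ~ range_is_asymptotic_point A : major_semiaxis A +oo%E.

Variant focal_distance A : \bar R -> Prop :=
| FocalOrdinary F1 F2 m of ~ has_real_eigenvalue A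
    & ordinary F1 & ordinary F2 & (hdist F1 F2 <= m%:E)%E
    & conformal_range A = [set x | (hdist F1 x + hdist F2 x <= m%:E)%E] :
    focal_distance A (hdist F1 F2)
| FocalDistinct (l : R) (mu : R[i]) of passmx.leigenvalue A l%:C
    & passmx.leigenvalue A mu & mu != l%:C : focal_distance A +oo%E
| FocalDouble (l : R) of char_poly (opmx A) = ('X - (l%:C)%:P) ^+ 2 :
    focal_distance A 0%E.

End Operator.

(* Main.v *)
Require Import Defs.
From HB Require Import structures.
From mathcomp Require Import all_boot all_order all_algebra.
From mathcomp Require Import all_classical all_reals all_analysis.
From mathcomp Require Import complex.
From mathcomp Require Import ring lra.

Set Implicit Arguments.
Unset Strict Implicit.
Unset Printing Implicit Defensive.

Import Order.TTheory GRing.Theory Num.Theory.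
Local Open Scope ring_scope.

(** Write l1 = a1 + i b1 and l2 = a2 + i b2 for the eigenvalues of A, and c for the
    off-diagonal entry of A in an orthonormal basis that makes it triangular
    ([ex_schur]). In these terms ([invariants_schur])
      E - |D| = b1 b2,
      E + |D| = (b1^2 + b2^2 + (a1 - a2)^2) / 2,
      U + E   = E + |D| + |c|^2 / 2.

    The point of the conformal range given by a vector x depends only on
    r = |Ax|^2, t = Re <Ax, x> and n = |x|^2 up to a common factor. In these coordinates
    the disk is the cone r n - t^2 > 0 seen projectively, and its hyperbolic metric comes
    from the Lorentz form r n - t^2: hence it is natural to compute on the hyperboloid.
    The eigenvalue l gives the vector (|l|^2, a, 1) of square b^2. If b1 b2 <> 0 these two
    vectors are time-like; they are the foci, and the Lorentz product of the unit vectors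
    along them shows that cosh of their distance is (E + |D|) / |b1 b2|.

    In the triangularizing basis r, t, n are linear in p = |x1|^2, q = |x2|^2 and the
    complex number w = conj(c) x1 conj(x2), subject to |w|^2 = |c|^2 p q. For given r, t, n
    everything is determined by q, which has to solve a quadratic equation. So the range is
    where a discriminant is nonnegative, and this discriminant is the quadratic form of the
    hyperbolic ellipse d(F1, x) + d(F2, x) <= m with cosh m = (U + E) / |b1 b2|
    ([shell_conic], [hellipse_conic]). For c = 0 the range is the segment between the foci,
    which is the same set with m = d(F1, F2) ([hsegment_hellipse], [shell_hellipse]).

    What remains is the geometry of the sets d(F1, x) + d(F2, x) <= m = 2 s. Such a set lies
    in the disk of radius s about the midpoint of the foci and contains a diameter of it, so
    this disk is the minimal one ([min_hdisk_hellipse]); as every case in the definition of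
    the semi-axis describes a set with a minimal disk of radius s, the semi-axis is m / 2 and
    nothing else. The focal distance is determined by the set too, because the set
    determines s and the semi-minor axis r, and cosh s = cosh r cosh e where 2 e is the
    focal distance ([focal_distance_unique]).

    If an eigenvalue is real, both denominators vanish and the conventions decide:
    U + E = 0 says that A is a real multiple of the identity ([shell_asymptotic]), and
    E + |D| = 0 that both eigenvalues are equal and real. *)

(** * Hyperbolic functions *)

Section Hyperbolic.
Context {R : realType}.
Implicit Types x y : R.

Definition cosh x : R := (expR x + expR (- x)) / 2.
Definition sinh x : R := (expR x - expR (- x)) / 2.

Lemma coshN x : cosh (- x) = cosh x.
Proof. by rewrite /cosh opprK addrC. Qed.

Lemma sinhN x : sinh (- x) = - sinh x.
Proof. by rewrite /sinh opprK -mulNr opprB. Qed.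

Lemma cosh0 : cosh 0 = 1.
Proof. by rewrite /cosh oppr0 expR0; lra. Qed.

Lemma coshD x y : cosh (x + y) = cosh x * cosh y + sinh x * sinh y.
Proof. by rewrite /cosh /sinh opprD !expRD; field. Qed.

Lemma coshB x y : cosh (x - y) = cosh x * cosh y - sinh x * sinh y.
Proof. by rewrite coshD coshN sinhN; ring. Qed.

Lemma cosh_sqr x : cosh x ^+ 2 = 1 + sinh x ^+ 2.
Proof.
have /= := expRD x (- x); rewrite subrr expR0 => h.
by rewrite /cosh /sinh; lra.
Qed.

Lemma sinh_sqr x : sinh x ^+ 2 = cosh x ^+ 2 - 1.
Proof. by rewrite cosh_sqr; ring. Qed.

Lemma cosh2 x : cosh (x + x) = 2 * cosh x ^+ 2 - 1.
Proof. by rewrite coshD -!expr2 sinh_sqr; ring. Qed.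

Lemma cosh_gt0 x : 0 < cosh x.
Proof. by rewrite /cosh divr_gt0 // addr_gt0 ?expR_gt0. Qed.

Lemma cosh_ge1 x : 1 <= cosh x.
Proof.
rewrite -(@ler_pXn2r _ 2) ?nnegrE ?(ltW (cosh_gt0 _)) //.
by rewrite expr1n cosh_sqr lerDl sqr_ge0.
Qed.

Lemma sinh_gt0 x : 0 < x -> 0 < sinh x.
Proof. by move=> x0; rewrite divr_gt0 // subr_gt0 ltr_expR; lra. Qed.

Lemma sinh_ge0 x : 0 <= x -> 0 <= sinh x.
Proof. by move=> x0; rewrite divr_ge0 // subr_ge0 ler_expR; lra. Qed.

Lemma ler_cosh : {in Num.nneg &, {mono cosh : x y / x <= y}}.
Proof.
apply: le_mono_in => x y; rewrite !nnegrE => x0 y0 xy.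
have e : cosh y - cosh x = 2 * (sinh ((y + x) / 2) * sinh ((y - x) / 2)).
  have {1}-> : y = (y + x) / 2 + (y - x) / 2 by lra.
  have {3}-> : x = (y + x) / 2 - (y - x) / 2 by lra.
  by rewrite coshD coshB; ring.
by rewrite -subr_gt0 e; do 2?[apply: mulr_gt0 => //]; apply: sinh_gt0; lra.
Qed.

Lemma cosh_norm x : cosh `|x| = cosh x.
Proof. by case: (ler0P x) => //; rewrite coshN. Qed.

Lemma ler_cosh_norm x y : 0 <= y -> (cosh x <= cosh y) = (`|x| <= y).
Proof. by move=> y0; rewrite -cosh_norm ler_cosh. Qed.

Lemma arcosh_ge0 x : 1 <= x -> 0 <= arcosh x.
Proof. by move=> x1; rewrite ln_ge0 // ler_wpDr ?sqrtr_ge0. Qed.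

Lemma arcoshK x : 1 <= x -> cosh (arcosh x) = x.
Proof.
move=> x1; rewrite /cosh /arcosh; set s := Num.sqrt _.
have s0 : 0 <= s := sqrtr_ge0 _.
have s2 : s ^+ 2 = x ^+ 2 - 1 by rewrite sqr_sqrtr // subr_ge0 exprn_ege1.
have p : 0 < x + s by lra.
rewrite expRN lnK ?posrE //.
by apply: (@mulIf _ (2 * (x + s))); [rewrite mulf_neq0 ?gt_eqF | field: s2; rewrite gt_eqF].
Qed.

Lemma coshK x : 0 <= x -> arcosh (cosh x) = x.
Proof.
move=> x0; have a0 := arcosh_ge0 (cosh_ge1 x).
have e := arcoshK (cosh_ge1 x).
by apply/eqP; rewrite eq_le -ler_cosh ?nnegrE // -[X in _ && X]ler_cosh ?nnegrE // e lexx.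
Qed.

Lemma arcosh1 : arcosh (1 : R) = 0.
Proof. by rewrite -cosh0 coshK. Qed.

Lemma ler_arcosh x y : 1 <= x -> 0 <= y -> (arcosh x <= y) = (x <= cosh y).
Proof. by move=> x1 y0; rewrite -ler_cosh ?nnegrE ?arcosh_ge0 ?arcoshK. Qed.

End Hyperbolic.
(** * The hyperboloid over the disk, distances and the triangle inequality *)

Section Lorentz.
Context {R : realType}.
Implicit Types (X Y Z A B C T N : R * R * R) (v w x F c : R * R) (a b m r s : R).

Definition lor X Y : R := X.1.1 * Y.1.1 - X.1.2 * Y.1.2 - X.2 * Y.2.

Definition comb a X b Y : R * R * R :=
  (a * X.1.1 + b * Y.1.1, a * X.1.2 + b * Y.1.2, a * X.2 + b * Y.2).

(** The determinant of three vectors; [cross] is dual to it for the Lorentz form. *)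
Definition vol X Y Z : R :=
  X.1.1 * (Y.1.2 * Z.2 - Y.2 * Z.1.2) - X.1.2 * (Y.1.1 * Z.2 - Y.2 * Z.1.1)
  + X.2 * (Y.1.1 * Z.1.2 - Y.1.2 * Z.1.1).

Definition cross X Y : R * R * R :=
  (X.1.2 * Y.2 - X.2 * Y.1.2, X.1.1 * Y.2 - X.2 * Y.1.1,
   X.1.2 * Y.1.1 - X.1.1 * Y.1.2).

Lemma lorC X Y : lor X Y = lor Y X.
Proof. by rewrite /lor; ring. Qed.

Lemma lor_combl a X b Y Z : lor (comb a X b Y) Z = a * lor X Z + b * lor Y Z.
Proof. by rewrite /lor /=; ring. Qed.

Lemma lor_combr a X b Y Z : lor Z (comb a X b Y) = a * lor Z X + b * lor Z Y.
Proof. by rewrite /lor /=; ring. Qed.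

Lemma lor_cross X Y Z : lor X (cross Y Z) = vol X Y Z.
Proof. by rewrite /lor /vol /=; ring. Qed.

Lemma gram X Y Z : vol X Y Z ^+ 2 =
  lor X X * (lor Y Y * lor Z Z - lor Y Z ^+ 2)
  - lor X Y * (lor X Y * lor Z Z - lor Y Z * lor X Z)
  + lor X Z * (lor X Y * lor Y Z - lor Y Y * lor X Z).
Proof. by rewrite /lor /vol; ring. Qed.

Lemma lor_cross_sqr X Y :
  lor (cross X Y) (cross X Y) = lor X X * lor Y Y - lor X Y ^+ 2.
Proof. by rewrite /lor /=; ring. Qed.

Definition future X : Prop := 0 < X.1.1 /\ lor X X = 1.

Definition lift v : R * R * R := (1, v.1, v.2).

Definition pt X : R * R := (X.1.2 / X.1.1, X.2 / X.1.1).

(** The point of the hyperboloid sheet lying over the disk point [v]; [pt] is the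
    inverse, the central projection. *)
Definition hyp v : R * R * R :=
  let k := (Num.sqrt (1 - dotp v v))^-1 in (k, k * v.1, k * v.2).

Lemma lor_lift v w : lor (lift v) (lift w) = 1 - dotp v w.
Proof. by rewrite /lor /dotp /=; ring. Qed.

Lemma ordinaryE v : ordinary v = (0 < lor (lift v) (lift v)).
Proof. by rewrite lor_lift subr_gt0. Qed.

Lemma sqrt_ord v : ordinary v -> 0 < Num.sqrt (1 - dotp v v).
Proof. by move=> ov; rewrite sqrtr_gt0 subr_gt0. Qed.

Lemma lor_hyp v w : lor (hyp v) (hyp w) =
  (1 - dotp v w) / (Num.sqrt (1 - dotp v v) * Num.sqrt (1 - dotp w w)).
Proof. by rewrite /lor /hyp /dotp /= invfM; ring. Qed.

Lemma future_hyp v : ordinary v -> future (hyp v).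
Proof.
move=> ov; have s0 := sqrt_ord ov; split; first by rewrite invr_gt0.
by rewrite lor_hyp -expr2 sqr_sqrtr ?divff // ?gt_eqF ?ltW // subr_gt0.
Qed.

Lemma hypK v : ordinary v -> pt (hyp v) = v.
Proof.
move=> ov; have /gt_eqF/negbT := sqrt_ord ov; rewrite /pt /hyp.
move: (Num.sqrt (1 - dotp v v)) => s s0.
by case: v ov => v1 v2 _ /=; congr (_, _); field; exact: s0.
Qed.

Lemma lor_pt X Y : X.1.1 != 0 -> Y.1.1 != 0 ->
  1 - dotp (pt X) (pt Y) = lor X Y / (X.1.1 * Y.1.1).
Proof.
case: X Y => [[x0 x1] x2] [[y0 y1] y2] /= X0 Y0.
by rewrite /dotp /lor /pt /=; field; rewrite X0 Y0.
Qed.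

Lemma ordinary_pt X : future X -> ordinary (pt X).
Proof.
move=> [X0 XX]; rewrite /ordinary -subr_gt0 lor_pt ?gt_eqF // XX.
by rewrite divr_gt0 ?mulr_gt0.
Qed.

Lemma ptK X : future X -> hyp (pt X) = X.
Proof.
move=> [X0 XX]; rewrite /hyp lor_pt ?gt_eqF // XX.
rewrite div1r -expr2 -exprVn sqrtr_sqr gtr0_norm ?invr_gt0 // invrK.
by case: X X0 XX => [[x0 x1] x2] /= /gt_eqF/negbT x0n _; congr (_, _, _); field.
Qed.

(** Lagrange's identity applied to [v] and [v - w]: it exhibits the reversed
    Cauchy-Schwarz defect of two points of the open disk as a nonnegative quantity that
    vanishes only for [v = w]. *)
Lemma reversed_CS_id v w : (1 - dotp v w) ^+ 2 - (1 - dotp v v) * (1 - dotp w w)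
  = (1 - dotp v v) * ((v.1 - w.1) ^+ 2 + (v.2 - w.2) ^+ 2)
    + (v.1 * (v.1 - w.1) + v.2 * (v.2 - w.2)) ^+ 2.
Proof. by rewrite /dotp; ring. Qed.

Lemma dotp_lt1 v w : ordinary v -> ordinary w -> dotp v w < 1.
Proof.
rewrite /ordinary /dotp => v1 w1.
have := sqr_ge0 (v.1 - w.1); have := sqr_ge0 (v.2 - w.2); nra.
Qed.

Lemma lor_ge1 X Y : future X -> future Y -> 1 <= lor X Y.
Proof.
move=> fX fY; have := fX => -[X0 XX]; have := fY => -[Y0 YY].
have := dotp_lt1 (ordinary_pt fX) (ordinary_pt fY).
have := reversed_CS_id (pt X) (pt Y).
rewrite -subr_gt0 !lor_pt ?gt_eqF // XX YY => e h.
have : 0 < X.1.1 * Y.1.1 by exact: mulr_gt0.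
move: h; rewrite pmulr_lgt0 ?invr_gt0 ?mulr_gt0 // => h p.
rewrite -(@ler_pXn2r _ 2) ?nnegrE ?(ltW h) // expr1n -subr_ge0.
have -> : lor X Y ^+ 2 - 1 = (X.1.1 * Y.1.1) ^+ 2 * ((lor X Y / (X.1.1 * Y.1.1)) ^+ 2
  - 1 / (X.1.1 * X.1.1) * (1 / (Y.1.1 * Y.1.1))).
  by field; rewrite !gt_eqF.
rewrite e mulr_ge0 ?sqr_ge0 // addr_ge0 ?sqr_ge0 // mulr_ge0 ?addr_ge0 ?sqr_ge0 //.
by rewrite divr_ge0 ?mulr_ge0 ?ltW.
Qed.

Lemma lor_eq1 X Y : future X -> future Y -> lor X Y = 1 -> X = Y.
Proof.
move=> fX fY XY1; have := fX => -[X0 XX]; have := fY => -[Y0 YY].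
rewrite -(ptK fX) -(ptK fY); congr hyp.
have := reversed_CS_id (pt X) (pt Y).
rewrite !lor_pt ?gt_eqF // XX YY XY1.
set k := 1 / (X.1.1 * X.1.1).
have k0 : 0 < k by rewrite divr_gt0 ?mulr_gt0.
have -> : (1 / (X.1.1 * Y.1.1)) ^+ 2 - k * (1 / (Y.1.1 * Y.1.1)) = 0.
  by rewrite /k; field; rewrite !gt_eqF.
case: (pt X) (pt Y) => [x1 x2] [y1 y2] /=.
have := sqr_ge0 (x1 * (x1 - y1) + x2 * (x2 - y2)); set u := _ ^+ 2 => u0 e.
have [h1 h2] : (x1 - y1) ^+ 2 = 0 /\ (x2 - y2) ^+ 2 = 0.
  by have := sqr_ge0 (x1 - y1); have := sqr_ge0 (x2 - y2); split; nra.
by move/eqP: h1; move/eqP: h2; rewrite !sqrf_eq0 !subr_eq0 => /eqP -> /eqP ->.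
Qed.

(** A unit time-like vector is on one of the two sheets of the hyperboloid, and the
    Lorentz product with a future vector tells which. *)
Lemma future_lor X Y : future X -> lor Y Y = 1 -> 0 < lor X Y -> future Y.
Proof.
case: X Y => [[x0 x1] x2] [[y0 y1] y2]; rewrite /future /lor /= => -[x00 xx] yy xy.
split=> //; rewrite ltNge; apply/negP => y00.
have h : (x1 * y1 + x2 * y2) ^+ 2 <= (x0 * y0) ^+ 2.
  have -> : (x0 * y0) ^+ 2 = (1 + x1 ^+ 2 + x2 ^+ 2) * (1 + y1 ^+ 2 + y2 ^+ 2).
    by rewrite exprMn; congr (_ * _); lra.
  have := sqr_ge0 (x1 * y2 - x2 * y1).
  have := sqr_ge0 x1; have := sqr_ge0 x2; have := sqr_ge0 y1; have := sqr_ge0 y2.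
  nra.
have : 0 <= x0 * - y0 by rewrite mulr_ge0 ?oppr_ge0 ?(ltW x00).
nra.
Qed.

Definition hd v w : R := arcosh (lor (hyp v) (hyp w)).

Lemma hdistE v w : ordinary v -> ordinary w -> hdist v w = (hd v w)%:E.
Proof. by move=> ov ow; rewrite /hdist ov ow /hd lor_hyp. Qed.

Lemma lor_hyp_ge1 v w : ordinary v -> ordinary w -> 1 <= lor (hyp v) (hyp w).
Proof. by move=> ov ow; apply: lor_ge1; exact: future_hyp. Qed.

Lemma cosh_hd v w : ordinary v -> ordinary w -> cosh (hd v w) = lor (hyp v) (hyp w).
Proof. by move=> ov ow; rewrite arcoshK // lor_hyp_ge1. Qed.

Lemma hd_ge0 v w : ordinary v -> ordinary w -> 0 <= hd v w.
Proof. by move=> ov ow; rewrite arcosh_ge0 // lor_hyp_ge1. Qed.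

Lemma hdvv v : ordinary v -> hd v v = 0.
Proof. by move=> /future_hyp [_ e]; rewrite /hd e arcosh1. Qed.

Lemma hd_eq0 v w : ordinary v -> ordinary w -> hd v w = 0 -> v = w.
Proof.
move=> ov ow e; have := cosh_hd ov ow; rewrite e cosh0 => /esym h.
by rewrite -(hypK ov) -(hypK ow) (lor_eq1 (future_hyp ov) (future_hyp ow) h).
Qed.

Lemma hdist_nord v w : ordinary v -> ~~ ordinary w -> hdist v w = +oo%E.
Proof.
move=> ov /negbTE ow; rewrite /hdist ov ow /=; case: eqP => // vw.
by rewrite -vw ov in ow.
Qed.

(** The Gram determinant of three hyperboloid points is a square. In terms of the
    distances it factors, and the sign of the product is the triangle inequality in
    all its forms. *)
Lemma gram_hyp v w x : ordinary v -> ordinary w -> ordinary x ->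
  (cosh (hd v x + hd w x) - cosh (hd v w))
  * (cosh (hd v x - hd w x) - cosh (hd v w)) = - vol (hyp x) (hyp v) (hyp w) ^+ 2.
Proof.
move=> ov ow ox; rewrite gram (coshD (hd v x) (hd w x)) coshB !cosh_hd //.
have [[_ ->] [_ ->]] := (future_hyp ov, future_hyp ow).
have [_ ->] := future_hyp ox.
rewrite (lorC (hyp x) (hyp v)) (lorC (hyp x) (hyp w)) -!cosh_hd //.
have := sinh_sqr (hd v x); have := sinh_sqr (hd w x).
move: (cosh _) (cosh _) (cosh _) (sinh _) (sinh _) => k a b s t sE tE.
transitivity ((a * b - k) ^+ 2 - t ^+ 2 * s ^+ 2); first by ring.
by rewrite sE tE; ring.
Qed.

(** If the left side were larger, then so would be [cosh] of the sum of the distances,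
    and both factors in [gram_hyp] would be positive. *)
Lemma cosh_diff_hd v w x : ordinary v -> ordinary w -> ordinary x ->
  cosh (hd v x - hd w x) <= cosh (hd v w).
Proof.
move=> ov ow ox; have := gram_hyp ov ow ox.
have : 0 <= sinh (hd v x) * sinh (hd w x).
  by rewrite mulr_ge0 ?sinh_ge0 ?hd_ge0.
rewrite (coshD (hd v x) (hd w x)) coshB; move: (cosh _) (cosh _ * cosh _) (sinh _ * sinh _) => k c s.
have := sqr_ge0 (vol (hyp x) (hyp v) (hyp w)); move: (_ ^+ 2) => d d0 s0 e.
by rewrite leNgt; apply/negP => h; nra.
Qed.

Definition hellipse F1 F2 m : set (R * R) :=
  [set x | (hdist F1 x + hdist F2 x <= m%:E)%E].

Lemma hellipseP F1 F2 m x : ordinary F1 -> ordinary F2 ->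
  hellipse F1 F2 m x <-> ordinary x /\ hd F1 x + hd F2 x <= m.
Proof.
move=> o1 o2; rewrite /hellipse /=.
have [ox|ox] := boolP (ordinary x).
  by rewrite !hdistE // -EFinD lee_fin; split=> // -[].
by rewrite !hdist_nord //; split=> // -[].
Qed.

Lemma hdiskP c r x : ordinary c -> hdisk c r x <-> ordinary x /\ hd c x <= r.
Proof.
move=> oc; rewrite /hdisk /=; have [ox|ox] := boolP (ordinary x).
  by rewrite hdistE // lee_fin; split=> // -[].
by rewrite hdist_nord //; split=> // -[].
Qed.

Lemma hdisk_hellipse c r : ordinary c -> hdisk c r = hellipse c c (2 * r).
Proof.
move=> oc; apply/seteqP; split=> x.
  by move/hdiskP => -/(_ oc) [ox h]; apply/hellipseP => //; split=> //; lra.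
by move/hellipseP => -/(_ oc oc) [ox h]; apply/hdiskP => //; split=> //; lra.
Qed.

Lemma set1_hellipse c : ordinary c -> [set c]%classic = hellipse c c 0.
Proof.
move=> oc; apply/seteqP; split=> x /=.
  by move=> ->; apply/hellipseP => //; rewrite hdvv //; split=> //; lra.
move/hellipseP => -/(_ oc oc) [ox h]; apply/esym/hd_eq0 => //.
by have := hd_ge0 oc ox; lra.
Qed.

Lemma hd_pt X Y : future X -> future Y -> hd (pt X) (pt Y) = arcosh (lor X Y).
Proof. by move=> fX fY; rewrite /hd !ptK. Qed.

(** The central projection turns the weights of a convex combination into arbitrary
    nonnegative coefficients of the vectors above. *)
Lemma hsegmentP X Y x : 0 < X.1.1 -> 0 < Y.1.1 ->
  hsegment (pt X) (pt Y) x <->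
  exists a b, [/\ 0 <= a, 0 <= b & lift x = comb a X b Y].
Proof.
case: X Y x => [[x0 x1] x2] [[y0 y1] y2] [z1 z2] /= px py.
rewrite /hsegment /pt /lift /comb /=; split.
  move=> [t /andP[t0 t1]] [-> ->]; exists ((1 - t) / x0), (t / y0); split.
  - by rewrite divr_ge0 ?subr_ge0 // ltW.
  - by rewrite divr_ge0 // ltW.
  - by congr (_, _, _); field; rewrite ?gt_eqF.
move=> [a [b [a0 b0 [e1 -> ->]]]]; exists (b * y0).
  have h1 : 0 <= b * y0 by rewrite mulr_ge0 // ltW.
  have h2 : 0 <= a * x0 by rewrite mulr_ge0 // ltW.
  by apply/andP; split; lra.
have -> : 1 - b * y0 = a * x0 by lra.
by congr (_, _); field; rewrite !gt_eqF.
Qed.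

End Lorentz.
(** * Hyperbolic ellipses: centre, vertices and minimal disk *)

Section Ellipses.
Context {R : realType}.
Implicit Types (X Y Z A B C T D P : R * R * R) (v w x y F c : R * R).
Implicit Types (a b e k m r s u : R) (S : set (R * R)).

(** The point at signed distance [u] from [C] on the geodesic with unit tangent [D]. *)
Definition geod C D u : R * R * R := comb (cosh u) C (sinh u) D.

Definition unit_normal C D : Prop := lor D D = -1 /\ lor C D = 0.

Lemma lor_geod C D u : future C -> unit_normal C D -> lor C (geod C D u) = cosh u.
Proof. by move=> [_ CC] [_ CD]; rewrite lor_combr CC CD; ring. Qed.

Lemma future_geod C D u : future C -> unit_normal C D -> future (geod C D u).
Proof.
move=> fC nD; have := fC => -[_ CC]; have := nD => -[DD CD].
apply: (future_lor fC); last by rewrite lor_geod // cosh_gt0.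
rewrite /geod lor_combl !lor_combr (lorC D C) CC DD CD.
by have := cosh_sqr u; move: (cosh u) (sinh u) => a b e; ring: e.
Qed.

Lemma unit_normal_cross C D : future C -> unit_normal C D ->
  unit_normal C (cross C D) /\ lor D (cross C D) = 0.
Proof.
move=> [_ CC] [DD CD]; split; last by rewrite lor_cross /vol; ring.
split; first by rewrite lor_cross_sqr CC DD CD; ring.
by rewrite lor_cross /vol; ring.
Qed.

Definition focal_frame F1 F2 C T e : Prop :=
  [/\ future C, unit_normal C T, 0 <= e,
      hyp F1 = geod C T (- e) & hyp F2 = geod C T e].

(** The witness is the first coordinate direction, moved by the Lorentz boost that
    takes the apex of the hyperboloid to [C]. *)
Lemma ex_unit_normal C : future C -> exists T, unit_normal C T.
Proof.
case: C => [[c0 c1] c2]; rewrite /future /lor /= => -[c00 cc].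
exists (c1, 1 + c1 ^+ 2 / (1 + c0), c1 * c2 / (1 + c0)).
have n0 : 1 + c0 != 0 by rewrite gt_eqF // addr_gt0.
have e2 : c2 * c2 = c0 * c0 - c1 * c1 - 1 by lra.
by split; rewrite /lor /=; field: e2.
Qed.

(** The centre is the normalized sum of the foci, the tangent their normalized
    difference; when the foci coincide, any direction at the common point will do. *)
Lemma ex_focal_frame F1 F2 : ordinary F1 -> ordinary F2 ->
  exists C T e, focal_frame F1 F2 C T e.
Proof.
move=> o1 o2; have [<-|F12] := eqVneq F1 F2.
  have fC := future_hyp o1; have [T nT] := ex_unit_normal fC.
  have g0 : hyp F1 = geod (hyp F1) T 0.
    rewrite /geod /comb cosh0 (_ : sinh 0 = 0); last by rewrite /sinh oppr0 subrr mul0r.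
    by rewrite !mul1r !mul0r !addr0 -!surjective_pairing.
  by exists (hyp F1), T, 0; split=> //; rewrite oppr0.
have [[fP1 P11] [fP2 P22]] := (future_hyp o1, future_hyp o2).
have d0 : 0 < hd F1 F2.
  rewrite lt_def hd_ge0 // andbT; apply: contra F12 => /eqP h.
  by rewrite (hd_eq0 o1 o2 h).
set e := hd F1 F2 / 2.
have e0 : 0 < e by rewrite divr_gt0.
have s0 : sinh e != 0 by rewrite gt_eqF // sinh_gt0.
have c0 : cosh e != 0 by rewrite gt_eqF // cosh_gt0.
have P12 : lor (hyp F1) (hyp F2) = 1 + 2 * sinh e ^+ 2.
  rewrite -cosh_hd // (_ : hd F1 F2 = e + e); last by rewrite /e; field.
  by rewrite cosh2 cosh_sqr; ring.
have c2 := cosh_sqr e.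
have [cp sp] := (cosh_gt0 e, sinh_gt0 e0).
have [chN shN] := (coshN e, sinhN e).
exists (comb (2 * cosh e)^-1 (hyp F1) (2 * cosh e)^-1 (hyp F2)),
  (comb (- (2 * sinh e)^-1) (hyp F1) (2 * sinh e)^-1 (hyp F2)), e.
rewrite /focal_frame /unit_normal /geod chN shN.
move: (cosh e) (sinh e) cp sp s0 c0 c2 P12 => ch sh cp sp sn cn c2 P12 {chN shN}; split.
- split; first by rewrite /= addr_gt0 // mulr_gt0 // invr_gt0 mulr_gt0.
  by rewrite lor_combl !lor_combr (lorC (hyp F2) (hyp F1)) P11 P22 P12; field: c2.
- split.
    by rewrite lor_combl !lor_combr (lorC (hyp F2) (hyp F1)) P11 P22 P12; field.
  rewrite lor_combl !lor_combr (lorC (hyp F2) (hyp F1)) P11 P22 P12.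
  by field; rewrite cn sn.
- exact: ltW.
- by case: (hyp F1) (hyp F2) => [[? ?] ?] [[? ?] ?]; rewrite /comb /=;
    congr (_, _, _); field; rewrite cn sn.
- by case: (hyp F1) (hyp F2) => [[? ?] ?] [[? ?] ?]; rewrite /comb /=;
    congr (_, _, _); field; rewrite cn sn.
Qed.

Lemma hd_foci F1 F2 C T e : ordinary F1 -> ordinary F2 ->
  focal_frame F1 F2 C T e -> hd F1 F2 = 2 * e.
Proof.
move=> o1 o2 [[_ CC] [TT CT] e0 h1 h2].
rewrite /hd h1 h2 /geod lor_combl !lor_combr (lorC T C) CC TT CT coshN sinhN.
rewrite -[RHS]coshK; last by rewrite mulr_ge0.
congr arcosh; rewrite mulr2n mulrDl mul1r coshD.
by move: (cosh e) (sinh e) => ? ?; ring.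
Qed.

Lemma lor_focus F1 F2 C T e X : focal_frame F1 F2 C T e ->
  lor (hyp F1) X = cosh e * lor C X - sinh e * lor T X /\
  lor (hyp F2) X = cosh e * lor C X + sinh e * lor T X.
Proof.
move=> [_ _ _ -> ->]; rewrite /geod !lor_combl coshN sinhN.
by split=> //; rewrite mulNr.
Qed.

(** On the hyperboloid the midpoint of the foci is proportional to their sum, and
    [cosh d1 + cosh d2 = 2 cosh ((d1 + d2) / 2) cosh ((d1 - d2) / 2)]. *)
Lemma lor_midpoint F1 F2 C T e x : ordinary F1 -> ordinary F2 -> ordinary x ->
  focal_frame F1 F2 C T e -> cosh e * lor C (hyp x) =
  cosh ((hd F1 x + hd F2 x) / 2) * cosh ((hd F1 x - hd F2 x) / 2).
Proof.
move=> o1 o2 ox ff; have [l1 l2] := lor_focus (hyp x) ff.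
have := cosh_hd o1 ox; have := cosh_hd o2 ox; rewrite l1 l2.
move: (hd F1 x) (hd F2 x) => d1 d2 E2 E1.
have e1 : cosh d1 = cosh ((d1 + d2) / 2 + (d1 - d2) / 2) by congr cosh; lra.
have e2 : cosh d2 = cosh ((d1 + d2) / 2 - (d1 - d2) / 2) by congr cosh; lra.
move: E1 E2; rewrite e1 e2 coshD coshB; lra.
Qed.

(** In [lor_midpoint] the first factor is at most [cosh s] by definition of the
    ellipse, the second at most [cosh e] by the triangle inequality. *)
Lemma hellipse_sub_hdisk F1 F2 C T e s : ordinary F1 -> ordinary F2 ->
  focal_frame F1 F2 C T e -> e <= s ->
  (hellipse F1 F2 (2 * s) `<=` hdisk (pt C) s)%classic.
Proof.
move=> o1 o2 ff es x /hellipseP -/(_ o1 o2) [ox h].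
have [fC _ e0 _ _] := ff; have oC := ordinary_pt fC.
apply/hdiskP => //; split=> //.
rewrite ler_arcosh ?lor_hyp_ge1 //; last by lra.
have := cosh_diff_hd o1 o2 ox; rewrite (hd_foci o1 o2 ff) ptK //.
have := lor_midpoint o1 o2 ox ff.
have := hd_ge0 o1 ox; have := hd_ge0 o2 ox.
move: (hd F1 x) (hd F2 x) h => d1 d2 h d20 d10 E.
rewrite ler_cosh_norm; last by lra.
move=> hdiff.
have hd2 : cosh ((d1 - d2) / 2) <= cosh e.
  rewrite ler_cosh_norm // normrM (@ger0_norm _ 2^-1) //; lra.
have hs : cosh ((d1 + d2) / 2) <= cosh s by rewrite ler_cosh ?nnegrE; lra.
rewrite -(ler_pM2l (cosh_gt0 e)) E mulrC; apply: ler_pM => //; exact/ltW/cosh_gt0.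
Qed.

Lemma vertex_in_hellipse F1 F2 C T e s : ordinary F1 -> ordinary F2 ->
  focal_frame F1 F2 C T e -> e <= s ->
  hellipse F1 F2 (2 * s) (pt (geod C T s)) /\
  hellipse F1 F2 (2 * s) (pt (geod C T (- s))).
Proof.
move=> o1 o2 ff es; have [fC nT e0 _ _] := ff.
have [[_ CC] [TT CT]] := (fC, nT).
have hv u : e <= `|u| -> hellipse F1 F2 (2 * `|u|) (pt (geod C T u)).
  move=> eu; have fX := future_geod u fC nT.
  apply/hellipseP => //; split; first exact: ordinary_pt.
  have [l1 l2] := lor_focus (geod C T u) ff.
  have lT : lor T (geod C T u) = - sinh u.
    by rewrite lor_combr lorC CT TT mulr0 add0r mulrN1.
  rewrite /hd ptK // l1 l2 lor_geod // lT mulrN opprK -coshD -coshB.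
  rewrite -(cosh_norm (e + u)) -(cosh_norm (e - u)) !coshK //.
  case: (ger0P u) eu => u0 eu.
    by rewrite (@ger0_norm _ (e + u)) ?(@ler0_norm _ (e - u)); lra.
  by rewrite (@ler0_norm _ (e + u)) ?(@ger0_norm _ (e - u)); lra.
split; first by have := hv s; rewrite ger0_norm; [exact | lra].
by have := hv (- s); rewrite normrN ger0_norm; [exact | lra].
Qed.

(** The two endpoints of the diameter sum to [2 cosh s] times the centre on the
    hyperboloid, so another centre sees them with a mean [cosh] of the distances equal
    to [cosh s] times a number that is at least 1, and is 1 only at [pt C]. *)
Lemma min_hdisk_of_diameter S C T s : future C -> unit_normal C T -> 0 <= s ->
  (S `<=` hdisk (pt C) s)%classic ->
  S (pt (geod C T s)) -> S (pt (geod C T (- s))) -> min_hdisk S (pt C) s.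
Proof.
move=> fC nT s0 sub S1 S2; split=> //; first exact: ordinary_pt.
move=> c r oc subc; have fc := future_hyp oc.
have [f1 f2] := (future_geod s fC nT, future_geod (- s) fC nT).
have /hdiskP -/(_ oc) [_ h1] := subc _ S1; have /hdiskP -/(_ oc) [_ h2] := subc _ S2.
have r0 : 0 <= r by apply: le_trans h1; rewrite hd_ge0 // ordinary_pt.
move: h1 h2; rewrite /hd !ptK // !ler_arcosh ?lor_ge1 //.
rewrite !lor_combr coshN sinhN => h1 h2.
have l1 := lor_ge1 fc fC.
have hs : cosh s * lor (hyp c) C <= cosh r by lra.
have c0 := cosh_gt0 s.
have sr : s <= r.
  by rewrite -ler_cosh ?nnegrE //; apply: le_trans hs; rewrite ler_peMr // ltW.
split=> // rs; rewrite -(hypK oc); congr pt; apply: lor_eq1 => //.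
apply: le_anti; rewrite l1 andbT.
by rewrite -(ler_pM2l c0) mulr1 -[in leRHS]rs.
Qed.

Lemma min_hdisk_hellipse F1 F2 C T e s : ordinary F1 -> ordinary F2 ->
  focal_frame F1 F2 C T e -> e <= s -> min_hdisk (hellipse F1 F2 (2 * s)) (pt C) s.
Proof.
move=> o1 o2 ff es; have [fC nT e0 _ _] := ff.
have [v1 v2] := vertex_in_hellipse o1 o2 ff es.
apply: (min_hdisk_of_diameter fC nT _ _ v1 v2); first lra.
exact: hellipse_sub_hdisk ff es.
Qed.

Lemma min_hdisk_unique S c c' r r' : min_hdisk S c r -> min_hdisk S c' r' ->
  c = c' /\ r = r'.
Proof.
move=> [oc sc hc] [oc' sc' hc'].
have [h1 h1'] := hc _ _ oc' sc'; have [h2 h2'] := hc' _ _ oc sc.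
have rr : r = r' by apply: le_anti; rewrite h1.
by split=> //; apply: h2'.
Qed.

Lemma hdiameter_vertices C T s : future C -> unit_normal C T -> 0 <= s ->
  hdiameter (pt C) s (pt (geod C T s)) (pt (geod C T (- s))).
Proof.
move=> fC nT s0; have [f1 f2] := (future_geod s fC nT, future_geod (- s) fC nT).
have oC := ordinary_pt fC.
have [q1 q2] := (ordinary_pt f1, ordinary_pt f2).
split=> //; rewrite ?hdistE // ?hd_pt // ?lor_geod // ?coshN ?coshK //.
have [[C0 _] [[p1 _] [p2 _]]] := (fC, (f1, f2)).
apply/hsegmentP => //; exists (2 * cosh s * C.1.1)^-1, (2 * cosh s * C.1.1)^-1.
have k0 : 0 <= (2 * cosh s * C.1.1)^-1.
  by rewrite invr_ge0 !mulr_ge0 // ltW // cosh_gt0.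
split=> //; rewrite /geod coshN sinhN.
move: C0 (cosh_gt0 s); move: (cosh s) (sinh s) => a b.
case: (C) (T) => [[x0 x1] x2] [[y0 y1] y2] /= /gt_eqF/negbT n0 /gt_eqF/negbT na.
by rewrite /lift /comb /pt /=; congr (_, _, _); field; rewrite n0 na.
Qed.

(** By the hyperbolic Pythagorean theorem for the centre, a focus and an end of the
    minor axis, [r] is the semi-minor axis. The disk is inside the ellipse since the
    second factor in [lor_midpoint] is at least 1. *)
Lemma hdisk_sub_hellipse F1 F2 C T e s r : ordinary F1 -> ordinary F2 ->
  focal_frame F1 F2 C T e -> e <= s -> cosh r * cosh e = cosh s -> 0 <= r ->
  (hdisk (pt C) r `<=` hellipse F1 F2 (2 * s))%classic.
Proof.
move=> o1 o2 ff es rs r0 x; have [fC nT e0 _ _] := ff.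
have oC := ordinary_pt fC; move/hdiskP => -/(_ oC) [ox h].
apply/hellipseP => //; split=> //.
move: h; rewrite ler_arcosh ?lor_hyp_ge1 // ptK // => h.
have := lor_midpoint o1 o2 ox ff.
have := hd_ge0 o1 ox; have := hd_ge0 o2 ox.
move: (hd F1 x) (hd F2 x) => d1 d2 d20 d10 E.
suff : (d1 + d2) / 2 <= s by lra.
rewrite -ler_cosh ?nnegrE; [|lra|lra].
rewrite -rs (mulrC (cosh r)); apply: (@le_trans _ _ (cosh e * lor C (hyp x))).
  by rewrite E ler_peMr ?cosh_ge1 // ltW // cosh_gt0.
by rewrite ler_pM2l ?cosh_gt0.
Qed.

(** The set determines its centre and [s], through the minimal disk, and then also the
    semi-minor axis [r], as the radius of the largest concentric disk inside it; then
    [e] follows from [cosh s = cosh r * cosh e]. *)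
Lemma focal_distance_unique F1 F2 F3 F4 m m' :
  ordinary F1 -> ordinary F2 -> ordinary F3 -> ordinary F4 ->
  hd F1 F2 <= m -> hd F3 F4 <= m' -> hellipse F1 F2 m = hellipse F3 F4 m' ->
  hd F1 F2 = hd F3 F4.
Proof.
move=> o1 o2 o3 o4.
have [C [T [e ff]]] := ex_focal_frame o1 o2.
have [C' [T' [e' ff']]] := ex_focal_frame o3 o4.
have -> : m = 2 * (m / 2) by field.
have -> : m' = 2 * (m' / 2) by field.
rewrite (hd_foci o1 o2 ff) (hd_foci o3 o4 ff').
move: (m / 2) (m' / 2) => s s' es es' eS.
have {}es : e <= s by lra.
have {}es' : e' <= s' by lra.
have := min_hdisk_hellipse o3 o4 ff' es'; rewrite -eS.
move/(min_hdisk_unique (min_hdisk_hellipse o1 o2 ff es)) => [cc ss].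
have [[fC nT e0 _ _] [fC' nT' e0' _ _]] := (ff, ff').
have {cc} CC : C = C' by rewrite -(ptK fC) cc ptK.
subst s' C'.
have key G1 G2 G3 G4 U U' g g' : ordinary G1 -> ordinary G2 ->
    ordinary G3 -> ordinary G4 -> focal_frame G1 G2 C U g ->
    focal_frame G3 G4 C U' g' -> g <= s -> g' <= s ->
    hellipse G1 G2 (2 * s) = hellipse G3 G4 (2 * s) -> g' <= g.
  move=> q1 q2 q3 q4 gf gf' gs gs' eG.
  have [[_ nU g0 _ _] [_ nU' g0' _ _]] := (gf, gf').
  have s0 : 0 <= s by lra.
  have cg : 1 <= cosh s / cosh g.
    by rewrite ler_pdivlMr ?cosh_gt0 // mul1r ler_cosh ?nnegrE.
  have gr : cosh (arcosh (cosh s / cosh g)) * cosh g = cosh s.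
    by rewrite arcoshK // divfK // gt_eqF // cosh_gt0.
  have r0 := arcosh_ge0 cg; move: (arcosh _) gr r0 => r gr r0.
  have [nN UN] := unit_normal_cross fC nU'.
  (* An end of the minor axis of the second ellipse, at distance [r]. *)
  set X := geod C (cross C U') r.
  have fX : future X := future_geod r fC nN.
  have : hdisk (pt C) r (pt X).
    apply/hdiskP; first exact: ordinary_pt.
    split; first exact: ordinary_pt.
    by rewrite hd_pt // lor_geod // coshK.
  move/(hdisk_sub_hellipse q1 q2 gf gs gr r0); rewrite eG.
  move/hellipseP => -/(_ q3 q4) [oX].
  have [l1 l2] := lor_focus X gf'.
  have [_ CU'] := nU'.
  rewrite /hd ptK // l1 l2 lor_geod // /X lor_combr UN (lorC U') CU' !mulr0 addr0.
  rewrite mulr0 subr0 addr0 => h.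
  have : arcosh (cosh g' * cosh r) <= s by lra.
  have cc1 : 1 <= cosh g' * cosh r by rewrite mulr_ege1 ?cosh_ge1.
  rewrite ler_arcosh // -gr mulrC ler_pM2l ?cosh_gt0 // ler_cosh ?nnegrE //.
congr (2 * _); apply: le_anti; apply/andP; split.
  exact: (key _ _ _ _ _ _ _ _ o3 o4 o1 o2 ff' ff).
exact: (key _ _ _ _ _ _ _ _ o1 o2 o3 o4 ff ff').
Qed.

End Ellipses.
(** * Segments as degenerate ellipses *)

Section Conics.
Context {R : realType}.
Implicit Types (X Y Z A B C T D P Q : R * R * R) (v w x y F c : R * R).
Implicit Types (a b e k m r s u : R) (S : set (R * R)).

Lemma hsegment_refl c : hsegment c c = [set c]%classic.
Proof.
apply/seteqP; split=> x; case: c => c1 c2; rewrite /hsegment /=.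
  by move=> [t _ ->]; congr (_, _); ring.
by move=> ->; exists 0; [rewrite lexx ler01 | congr (_, _); ring].
Qed.

(** Cramer's rule with the Gram matrix of [P] and [Q] in place of a coordinate matrix. *)
Lemma vol_expand X P Q : vol X P Q = 0 -> lor P P = 1 -> lor Q Q = 1 ->
  lor P Q ^+ 2 != 1 ->
  X = comb ((lor P Q * lor Q X - lor P X) / (lor P Q ^+ 2 - 1)) P
           ((lor P Q * lor P X - lor Q X) / (lor P Q ^+ 2 - 1)) Q.
Proof.
move=> v0 PP QQ; rewrite -subr_eq0 => k0.
have e (i j k l : R) : i * (lor P P * lor Q Q - lor P Q ^+ 2) =
    (lor P X * lor Q Q - lor P Q * lor Q X) * j
    + (lor Q X * lor P P - lor P Q * lor P X) * k + vol X P Q * l ->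
    i = (lor P Q * lor Q X - lor P X) / (lor P Q ^+ 2 - 1) * j +
        (lor P Q * lor P X - lor Q X) / (lor P Q ^+ 2 - 1) * k.
  rewrite v0 PP QQ; move: (lor P X) (lor Q X) (lor P Q) k0 => a b c k0 h.
  apply: (mulIf k0); transitivity (- (i * (1 * 1 - c ^+ 2))); first by ring.
  by rewrite h; field.
rewrite [LHS]surjective_pairing [X in (X, _)]surjective_pairing /comb.
congr (_, _, _).
- by apply: (e _ _ _ (cross P Q).1.1); rewrite /lor /vol /cross /=; ring.
- by apply: (e _ _ _ (cross P Q).1.2); rewrite /lor /vol /cross /=; ring.
- by apply: (e _ _ _ (cross P Q).2); rewrite /lor /vol /cross /=; ring.
Qed.

Lemma hyp_lift x : hyp x = comb (hyp x).1.1 (lift x) 0 (lift x).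
Proof. by rewrite /hyp /comb /=; congr (_, _, _); ring. Qed.

(** Equality in the triangle inequality makes the Gram determinant vanish, so the point
    is a combination of the foci; the bound on the distances makes the coefficients
    nonnegative. *)
Lemma hsegment_hellipse F1 F2 : ordinary F1 -> ordinary F2 ->
  hsegment F1 F2 = hellipse F1 F2 (hd F1 F2).
Proof.
move=> o1 o2; have [<-|F12] := eqVneq F1 F2.
  by rewrite hdvv // -set1_hellipse // hsegment_refl.
have [f1 f2] := (future_hyp o1, future_hyp o2).
have [[P0 PP] [Q0 QQ]] := (f1, f2).
have d0 : 0 < hd F1 F2.
  rewrite lt_def hd_ge0 // andbT; apply: contra F12 => /eqP h.
  by rewrite (hd_eq0 o1 o2 h).
have k1 : 1 < lor (hyp F1) (hyp F2).
  by rewrite -cosh_hd // -(cosh0 (R := R)) ltNge ler_cosh ?nnegrE ?hd_ge0 // -ltNge.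
rewrite -{1}(hypK o1) -{1}(hypK o2).
apply/seteqP; split=> x.
  move/hsegmentP => -/(_ P0 Q0) [a [b [a0 b0 e]]].
  have Lx : lor (lift x) (lift x) = a ^+ 2 + b ^+ 2 + 2 * a * b * lor (hyp F1) (hyp F2).
    rewrite e lor_combl !lor_combr PP QQ (lorC (hyp F2) (hyp F1)).
    by move: (lor _ _) => ?; ring.
  have ab0 : 0 < a + b.
    rewrite lt_def addr_ge0 // andbT; apply/eqP => ab.
    have [a00 b00] : a = 0 /\ b = 0 by split; lra.
    by move: e; rewrite a00 b00 /lift /comb !mul0r addr0 => -[/eqP]; rewrite oner_eq0.
  have ox : ordinary x.
    rewrite ordinaryE Lx.
    move: (lor (hyp F1) _) k1 => k k1; have : 0 <= a * b by rewrite mulr_ge0.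
    have : 0 < (a + b) ^+ 2 by rewrite exprn_gt0.
    by move=> h1 h2; nra.
  apply/hellipseP => //; split=> //.
  have [x0 XX] := future_hyp ox.
  have eX : hyp x = comb ((hyp x).1.1 * a) (hyp F1) ((hyp x).1.1 * b) (hyp F2).
    by rewrite [LHS]hyp_lift e /comb /=; congr (_, _, _); ring.
  have : 0 <= (hyp x).1.1 * a by rewrite mulr_ge0 // ltW.
  have : 0 <= (hyp x).1.1 * b by rewrite mulr_ge0 // ltW.
  move: (_ * a) (_ * b) eX => c d eX d00 c0 {e Lx ab0 a0 b0}.
  have E1 := cosh_hd o1 ox; have E2 := cosh_hd o2 ox.
  have E0 := cosh_hd o1 o2.
  have sq i j l : 0 <= i -> 0 <= j -> 0 <= l -> cosh i ^+ 2 - 1 = l ^+ 2 * sinh j ^+ 2 ->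
      sinh i = l * sinh j.
    move=> i0 j0 l0; rewrite -sinh_sqr -exprMn => /eqP.
    have [h1 h2] := (sinh_ge0 i0, mulr_ge0 l0 (sinh_ge0 j0)).
    by rewrite eqrXn2 // => /eqP.
  have XX' : c ^+ 2 + d ^+ 2 + 2 * c * d * lor (hyp F1) (hyp F2) = 1.
    transitivity (lor (hyp x) (hyp x)) => //; rewrite eX lor_combl !lor_combr PP QQ (lorC (hyp F2) (hyp F1)).
    by move: (lor _ _) => ?; ring.
  move: E1 E2; rewrite eX !lor_combr PP QQ (lorC (hyp F2) (hyp F1)) -E0 !mulr1 => E1 E2.
  rewrite -E0 in XX'.
  have {}XX' : c ^+ 2 = 1 - d ^+ 2 - 2 * c * d * cosh (hd F1 F2).
    by move: (cosh _) XX' => k XX'; clear -XX'; lra.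
  have S1 : sinh (hd F1 x) = d * sinh (hd F1 F2).
    apply: sq => //; [exact: hd_ge0 | exact: hd_ge0 |].
    rewrite E1 sinh_sqr; move: (cosh _) XX' => k XX'; ring: XX'.
  have S2 : sinh (hd F2 x) = c * sinh (hd F1 F2).
    apply: sq => //; [exact: hd_ge0 | exact: hd_ge0 |].
    rewrite E2 sinh_sqr; move: (cosh _) XX' => k XX'; ring: XX'.
  rewrite -ler_cosh ?nnegrE ?addr_ge0 ?hd_ge0 //.
  rewrite coshD S1 S2 E1 E2.
  have := sinh_sqr (hd F1 F2); move: (cosh _) (sinh _) XX' => k s XX' s2.
  by rewrite le_eqVlt; apply/orP; left; apply/eqP; ring: XX' s2.
move/hellipseP => -/(_ o1 o2) [ox h].
have [x0 XX] := future_hyp ox.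
have h1 : cosh (hd F1 x + hd F2 x) <= cosh (hd F1 F2).
  by rewrite ler_cosh ?nnegrE ?addr_ge0 ?hd_ge0.
have h2 := cosh_diff_hd o1 o2 ox.
have v0 : vol (hyp x) (hyp F1) (hyp F2) = 0.
  apply/eqP; rewrite -sqrf_eq0; apply/eqP/le_anti; rewrite sqr_ge0 andbT.
  by rewrite -oppr_ge0 -gram_hyp // mulr_le0 // subr_le0.
have kn : lor (hyp F1) (hyp F2) ^+ 2 - 1 > 0 by rewrite subr_gt0 exprn_egt1.
have nk : lor (hyp F1) (hyp F2) ^+ 2 != 1 by rewrite -subr_eq0 gt_eqF.
have e := vol_expand v0 PP QQ nk.
apply/hsegmentP => //.
exists ((hyp x).1.1^-1 * ((lor (hyp F1) (hyp F2) * lor (hyp F2) (hyp x)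
          - lor (hyp F1) (hyp x)) / (lor (hyp F1) (hyp F2) ^+ 2 - 1))),
       ((hyp x).1.1^-1 * ((lor (hyp F1) (hyp F2) * lor (hyp F1) (hyp x)
          - lor (hyp F2) (hyp x)) / (lor (hyp F1) (hyp F2) ^+ 2 - 1))).
have aux (u v : R) : 0 <= u -> 0 <= v -> u + v <= hd F1 F2 ->
    cosh u <= cosh (hd F1 F2) * cosh v.
  move=> u0 v0' uv; have := coshD (hd F1 F2) v; have := coshB (hd F1 F2) v.
  have : 0 <= sinh (hd F1 F2) * sinh v by rewrite mulr_ge0 ?sinh_ge0 // ltW.
  have : cosh u <= cosh (hd F1 F2 - v) by rewrite ler_cosh ?nnegrE; lra.
  lra.
split.
- rewrite mulr_ge0 // ?invr_ge0 ?(ltW x0) // divr_ge0 // ?(ltW kn) // subr_ge0.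
  by rewrite -!cosh_hd //; apply: aux; rewrite ?hd_ge0.
- rewrite mulr_ge0 // ?invr_ge0 ?(ltW x0) // divr_ge0 // ?(ltW kn) // subr_ge0.
  by rewrite -!cosh_hd //; apply: aux; rewrite ?hd_ge0 // addrC.
- have -> : lift x = comb (hyp x).1.1^-1 (hyp x) 0 (hyp x).
    have /gt_eqF/negbT := x0; rewrite /hyp /comb /lift /= => n0.
    by congr (_, _, _); field; move: n0; rewrite invr_eq0.
  have scale X P Q (c p q : R) : X = comb p P q Q ->
      comb c X 0 X = comb (c * p) P (c * q) Q.
    by move=> ->; rewrite /comb /=; congr (_, _, _); ring.
  exact: scale.
Qed.

End Conics.
(** * Hyperbolic ellipses as Euclidean ellipses *)

Section FilledEllipses.
Context {R : realType}.
Implicit Types (X Y Z A B C T D P Q : R * R * R) (v w x y F c : R * R).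
Implicit Types (a b e k m r s u : R) (S : set (R * R)).

(** For a unit time-like [Y] at distances [d1], [d2] from [P], [Q] this is
    [(cosh (d1 + d2) - k) * (cosh (d1 - d2) - k)]. *)
Definition conic k P Q Y : R :=
  (k ^+ 2 - 1) * lor Y Y + lor P Y ^+ 2 + lor Q Y ^+ 2 - 2 * k * lor P Y * lor Q Y.

Lemma conic_scale k P Q Y Z u : conic k P Q (comb u Y 0 Z) = u ^+ 2 * conic k P Q Y.
Proof.
rewrite /conic lor_combl !lor_combr !mul0r !addr0.
by move: (lor _ _) (lor _ _) (lor _ _) => *; ring.
Qed.

Lemma conic_split k P Q Y : lor P P = 1 -> lor Q Q = 1 -> conic k P Q Y =
  (k - lor P Q) * ((k + lor P Q) * lor Y Y - 2 * lor P Y * lor Q Y)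
  - vol Y P Q ^+ 2.
Proof.
move=> PP QQ; rewrite gram PP QQ (lorC Y P) (lorC Y Q) /conic.
by move: (lor _ _) (lor _ _) (lor _ _) (lor _ _) => *; ring.
Qed.

(** By [gram] the form with [k] replaced by [lor P Q] is nonpositive everywhere, and
    [conic_split] compares the two forms. Hence the conic stays inside the disk, and
    its quadratic part is definite. *)
Lemma conic_nontimelike k P Q Y : future P -> future Q -> lor P Q < k ->
  lor Y Y <= 0 -> 0 <= conic k P Q Y -> lor Y Y = 0 /\ lor P Y = 0.
Proof.
move=> fP fQ; have k1 := lor_ge1 fP fQ.
have [[_ PP] [_ QQ]] := (fP, fQ).
have := conic_split (lor P Q) Y PP QQ; rewrite subrr mul0r add0r => h0.
move=> hk q0; rewrite (conic_split k Y PP QQ) => hc.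
move: h0 hc; rewrite /conic; have := sqr_ge0 (vol Y P Q).
move: (vol _ _ _ ^+ 2) (lor P Q) (lor Y Y) (lor P Y) (lor Q Y) k1 hk q0.
move=> d k0 q a b k1 hk q0 d0 e hc.
have h : 0 <= (k + k0) * q - 2 * a * b.
  have kk : 0 < k - k0 by rewrite subr_gt0.
  by rewrite -(pmulr_rge0 _ kk); lra.
have kq : (k + k0) * q <= 0 by rewrite mulr_ge0_le0 //; lra.
have [ab|ab] := lerP 0 (a * b).
  have ab0 : a * b = 0 by lra.
  have : (k + k0) * q = 0 by lra.
  move/eqP; rewrite mulf_eq0 => /orP[/eqP|/eqP q00]; first lra.
  split=> //; have : a ^+ 2 + b ^+ 2 <= 0.
    have -> : a ^+ 2 + b ^+ 2 = - d + 2 * k0 * (a * b) - (k0 ^+ 2 - 1) * q.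
      by rewrite -e; ring.
    by rewrite ab0 q00; lra.
  move=> h2; have := sqr_ge0 a; have := sqr_ge0 b => b0 a0.
  by apply/eqP; rewrite -sqrf_eq0; apply/eqP; lra.
(* Now [a * b < 0]; its size is bounded by the form with [k0], as [(a + b)^2 >= 0]. *)
have h3 : (k0 + 1) * (- (2 * a * b)) <= (k0 + 1) * ((k0 - 1) * - q).
  have := sqr_ge0 (a + b).
  have -> : (a + b) ^+ 2 = (a ^+ 2 + b ^+ 2 - 2 * k0 * a * b) + (k0 + 1) * (2 * a * b).
    by ring.
  have -> : (k0 + 1) * ((k0 - 1) * - q) = - ((k0 ^+ 2 - 1) * q) by ring.
  lra.
move: h3; rewrite ler_pM2l; last by lra.
move=> h3; have : (k + 1) * q <= 0 by rewrite mulr_ge0_le0 //; lra.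
have : (k + 1) * q >= 0 by lra.
move=> h4 h5; have : (k + 1) * q = 0 by apply: le_anti; rewrite h5.
move/eqP; rewrite mulf_eq0 => /orP[/eqP|/eqP q00]; first lra.
by move: h3; rewrite q00; lra.
Qed.

Lemma ordinary_of_conic k P Q y : future P -> future Q -> lor P Q < k ->
  0 <= conic k P Q (lift y) -> ordinary y.
Proof.
move=> fP fQ hk hc; rewrite ordinaryE ltNge; apply/negP => q0.
have := conic_nontimelike fP fQ hk q0 hc.
case: fP => P0 PP; move: P0 PP; case: P y {hc hk q0} => [[p0 p1] p2] [y1 y2].
rewrite /lor /= => P0 PP [e1 e2].
have h1 : p0 = p1 * y1 + p2 * y2 by lra.
have h2 : y1 ^+ 2 + y2 ^+ 2 = 1 by lra.
have : p0 ^+ 2 <= p1 ^+ 2 + p2 ^+ 2.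
  rewrite h1 -subr_ge0; have -> : p1 ^+ 2 + p2 ^+ 2 - (p1 * y1 + p2 * y2) ^+ 2
    = (p1 ^+ 2 + p2 ^+ 2) * (1 - (y1 ^+ 2 + y2 ^+ 2)) + (p1 * y2 - p2 * y1) ^+ 2 by ring.
  by rewrite h2 subrr mulr0 add0r sqr_ge0.
lra.
Qed.

(** The factor [cosh (d1 - d2) - k] is negative by the triangle inequality, so the sign
    of the form is decided by the other one. *)
Lemma hellipse_conic F1 F2 m : ordinary F1 -> ordinary F2 -> hd F1 F2 < m ->
  hellipse F1 F2 m =
  [set x | 0 <= conic (cosh m) (hyp F1) (hyp F2) (lift x)]%classic.
Proof.
move=> o1 o2 hm; have [f1 f2] := (future_hyp o1, future_hyp o2).
have m0 : 0 <= m by apply: le_trans (ltW hm); exact: hd_ge0.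
have km : cosh (hd F1 F2) < cosh m.
  by rewrite ltNge ler_cosh ?nnegrE ?hd_ge0 // -ltNge.
have key x : ordinary x -> (hd F1 x + hd F2 x <= m) =
    (0 <= conic (cosh m) (hyp F1) (hyp F2) (lift x)).
  move=> ox; have [x0 XX] := future_hyp ox.
  rewrite -(pmulr_rge0 _ (exprn_gt0 2 x0)).
  rewrite -(conic_scale _ _ _ _ (lift x)) -hyp_lift /conic XX -!cosh_hd //.
  rewrite -ler_cosh ?nnegrE ?(addr_ge0 (hd_ge0 o1 ox) (hd_ge0 o2 ox)) //.
  have := cosh_diff_hd o1 o2 ox.
  have [] := (coshD (hd F1 x) (hd F2 x), coshB (hd F1 x) (hd F2 x)).
  have [] := (sinh_sqr (hd F1 x), sinh_sqr (hd F2 x)).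
  move: (cosh (hd F1 x + hd F2 x)) (cosh (hd F1 x - hd F2 x)) => p q.
  move: (cosh (hd F1 F2)) (cosh m) km => k0 k km.
  move: (cosh (hd F1 x)) (cosh (hd F2 x)) (sinh (hd F1 x)) (sinh (hd F2 x)).
  move=> a b s t hs ht hp hq qk.
  have -> : (k ^+ 2 - 1) * 1 + a ^+ 2 + b ^+ 2 - 2 * k * a * b = (k - p) * (k - q).
    by rewrite hp hq; ring: hs ht.
  by rewrite pmulr_lge0 ?subr_ge0 // subr_gt0; apply: le_lt_trans km.
apply/seteqP; split=> x /=.
  by move=> /hellipseP -/(_ o1 o2) [ox]; rewrite key.
move=> hc; have ox : ordinary x.
  by apply: (ordinary_of_conic f1 f2 _ hc); rewrite -cosh_hd.
by apply/hellipseP => //; split=> //; rewrite key.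
Qed.

(** Completing the square: [(o1, o2)] is the centre and [w] the minimum of the
    polynomial, negative because the polynomial is negative at [y]. *)
Lemma filled_ellipse_quadric (al be ga de ep ze : R) (y : R * R) S :
  let f (x : R * R) := al * x.1 ^+ 2 + 2 * be * x.1 * x.2 + ga * x.2 ^+ 2
    + 2 * de * x.1 + 2 * ep * x.2 + ze in
  0 < al -> 0 < al * ga - be ^+ 2 -> f y < 0 ->
  S = [set x | f x <= 0]%classic -> is_filled_ellipse S.
Proof.
move=> f al0 D0 fy ->.
set D := al * ga - be ^+ 2 in D0.
set o1 := (be * ep - ga * de) / D; set o2 := (be * de - al * ep) / D.
set w := ze + de * o1 + ep * o2.
have Dn : D != 0 by rewrite gt_eqF.
have fE x : f x = al * (x.1 - o1) ^+ 2 + 2 * be * (x.1 - o1) * (x.2 - o2)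
    + ga * (x.2 - o2) ^+ 2 + w.
  have e1 : al * o1 + be * o2 = - de by rewrite /o1 /o2 /D; field.
  have e2 : be * o1 + ga * o2 = - ep by rewrite /o1 /o2 /D; field.
  rewrite /f /w; have -> : de = - (al * o1 + be * o2) by rewrite e1 opprK.
  by have -> : ep = - (be * o1 + ga * o2); [rewrite e2 opprK | ring].
have sq (i j : R) : 0 <= al * i ^+ 2 + 2 * be * i * j + ga * j ^+ 2.
  rewrite -(pmulr_rge0 _ al0).
  have -> : al * (al * i ^+ 2 + 2 * be * i * j + ga * j ^+ 2)
     = (al * i + be * j) ^+ 2 + D * j ^+ 2 by rewrite /D; ring.
  by rewrite addr_ge0 ?sqr_ge0 // mulr_ge0 ?sqr_ge0 // ltW.
have w0 : 0 < - w by move: fy; rewrite fE; have := sq (y.1 - o1) (y.2 - o2); lra.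
have wn : - w != 0 by rewrite gt_eqF.
exists (o1, o2), (al / - w), (be / - w), (ga / - w); split.
- by rewrite divr_gt0.
- have -> : al / - w * (ga / - w) - (be / - w) ^+ 2 = D / (- w) ^+ 2.
    by rewrite /D; move: (- w) wn => ? ?; field.
  by rewrite divr_gt0 // exprn_gt0.
- apply/seteqP; split=> x /=; rewrite fE -[in X in _ -> X]subr_ge0 -[in X in X -> _]subr_ge0.
    move=> h; rewrite -(pmulr_rge0 _ w0); move: h.
    set t := (X in 0 <= X -> _); set t' := (X in _ -> 0 <= X).
    by have -> : t' = t by rewrite /t' /t; move: (- w) wn (opprK w) => v vn <-; field.
  move=> h; have := h; rewrite -(pmulr_rge0 _ w0).
  set t := (X in 0 <= X -> _); set t' := (X in _ -> 0 <= X).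
  by have -> : t' = t by rewrite /t' /t; move: (- w) wn (opprK w) => v vn <-; field.
Qed.

Lemma filled_ellipse_convex S x y : is_filled_ellipse S -> S x -> S y ->
  (hsegment x y `<=` S)%classic.
Proof.
move=> [[c1 c2] [p [q [u [p0 D0 ->]]]]] /= hx hy z [t /andP[t0 t1]] -> /=.
case: x y hx hy => [x1 x2] [y1 y2] /= hx hy.
have sq : 0 <= p * (x1 - y1) ^+ 2 + 2 * q * (x1 - y1) * (x2 - y2) + u * (x2 - y2) ^+ 2.
  rewrite -(pmulr_rge0 _ p0).
  have -> : p * (p * (x1 - y1) ^+ 2 + 2 * q * (x1 - y1) * (x2 - y2) + u * (x2 - y2) ^+ 2)
     = (p * (x1 - y1) + q * (x2 - y2)) ^+ 2 + (p * u - q ^+ 2) * (x2 - y2) ^+ 2 by ring.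
  by rewrite addr_ge0 ?sqr_ge0 // mulr_ge0 ?sqr_ge0 // ltW.
have {}t1 : 0 <= 1 - t by rewrite subr_ge0.
have h1 := ler_wpM2l t1 hx; have h2 := ler_wpM2l t0 hy.
have h3 := mulr_ge0 (mulr_ge0 t0 t1) sq.
rewrite -subr_ge0.
set f := (X in 1 - X).
suff -> : 1 - f = ((1 - t) * 1 - (1 - t) * (p * (x1 - c1) ^+ 2 + 2 * q * (x1 - c1) * (x2 - c2)
   + u * (x2 - c2) ^+ 2)) + (t * 1 - t * (p * (y1 - c1) ^+ 2 + 2 * q * (y1 - c1) * (y2 - c2)
   + u * (y2 - c2) ^+ 2)) + t * (1 - t) * (p * (x1 - y1) ^+ 2 + 2 * q * (x1 - y1) * (x2 - y2)
   + u * (x2 - y2) ^+ 2).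
  by apply: addr_ge0 => //; apply: addr_ge0; rewrite subr_ge0.
by rewrite /f; ring.
Qed.

Lemma hellipse_filled F1 F2 m : ordinary F1 -> ordinary F2 -> hd F1 F2 < m ->
  is_filled_ellipse (hellipse F1 F2 m).
Proof.
move=> o1 o2 hm; have [f1 f2] := (future_hyp o1, future_hyp o2).
have m0 : 0 <= m by apply: le_trans (ltW hm); exact: hd_ge0.
have km : cosh (hd F1 F2) < cosh m.
  by rewrite ltNge ler_cosh ?nnegrE ?hd_ge0 // -ltNge.
rewrite hellipse_conic //; rewrite cosh_hd // in km.
have F1neg : 0 < conic (cosh m) (hyp F1) (hyp F2) (lift F1).
  have [x0 XX] := f1.
  rewrite -(pmulr_rgt0 _ (exprn_gt0 2 x0)).
  rewrite -(conic_scale _ _ _ _ (lift F1)) -hyp_lift /conic XX (lorC (hyp F2)).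
  move: (lor _ _) (cosh m) km => k0 k km.
  have -> : (k ^+ 2 - 1) * 1 + 1 ^+ 2 + k0 ^+ 2 - 2 * k * 1 * k0 = (k - k0) ^+ 2 by ring.
  by rewrite exprn_gt0 // subr_gt0.
(* A direction [(0, i, j)] is space-like, so the quadratic part of the polynomial is
   definite; its matrix is [al, be; be, ga]. *)
have neg (i j : R) : (i != 0) || (j != 0) ->
    conic (cosh m) (hyp F1) (hyp F2) (0, i, j) < 0.
  move=> ij; rewrite ltNge; apply/negP => h.
  have q : lor (0, i, j) (0, i, j) < 0.
    have -> : lor (0, i, j) (0, i, j) = - (i ^+ 2 + j ^+ 2) by rewrite /lor /=; ring.
    rewrite oppr_lt0 lt_def addr_ge0 ?sqr_ge0 // andbT paddr_eq0 ?sqr_ge0 //.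
    by rewrite !sqrf_eq0 negb_and.
  have [q0 _] := conic_nontimelike f1 f2 km (ltW q) h.
  by rewrite q0 ltxx in q.
move: F1neg neg; case: (hyp F1) (hyp F2) (cosh m) => [[p0 p1] p2] [[q0 q1] q2] k F1neg neg.
pose al := (k ^+ 2 - 1) - p1 ^+ 2 - q1 ^+ 2 + 2 * k * p1 * q1.
pose be := - p1 * p2 - q1 * q2 + k * (p1 * q2 + p2 * q1).
pose ga := (k ^+ 2 - 1) - p2 ^+ 2 - q2 ^+ 2 + 2 * k * p2 * q2.
have dirE i j : conic k (p0, p1, p2) (q0, q1, q2) (0, i, j) =
    - (al * i ^+ 2 + 2 * be * i * j + ga * j ^+ 2).
  by rewrite /conic /lor /al /be /ga /=; ring.
have al0 : 0 < al.
  by have := neg 1 0; rewrite dirE oner_eq0 => /(_ isT); lra.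
have D0 : 0 < al * ga - be ^+ 2.
  have := neg be (- al); rewrite dirE oppr_eq0 (gt_eqF al0) orbT => /(_ isT) h.
  rewrite -(pmulr_rgt0 _ al0); lra.
apply: (@filled_ellipse_quadric al be ga (p0 * p1 + q0 * q1 - k * (p0 * q1 + q0 * p1))
  (p0 * p2 + q0 * q2 - k * (p0 * q2 + q0 * p2))
  (- (k ^+ 2 - 1) - p0 ^+ 2 - q0 ^+ 2 + 2 * k * p0 * q0) F1) => //=.
  move: F1neg; rewrite -oppr_lt0; congr (_ < 0).
  by rewrite /conic /lor /lift /al /be /ga /=; case: (F1) => ? ?; rewrite /=; ring.
apply/seteqP; split=> -[x1 x2] /=; rewrite -oppr_le0; congr (_ <= 0);
  by rewrite /conic /lor /lift /al /be /ga /=; ring.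
Qed.

Lemma ordinary_semimajor_hellipse F1 F2 s : ordinary F1 -> ordinary F2 ->
  hd F1 F2 <= 2 * s -> ordinary_semimajor (hellipse F1 F2 (2 * s)) s.
Proof.
move=> o1 o2 hs; have [eF|F12] := eqVneq F1 F2.
  subst F2; rewrite hdvv // in hs.
  have [s0|s0] := eqVneq s 0.
    by rewrite s0 mulr0; apply: (SemimajorPoint o1); rewrite set1_hellipse.
  apply: (SemimajorDisk o1); last by rewrite hdisk_hellipse.
  by rewrite lt_def s0 /=; lra.
have [es|es] := eqVneq (hd F1 F2) (2 * s).
  apply: (SemimajorSegment o1 o2 F12); last by rewrite hdistE ?es.
  by rewrite -es hsegment_hellipse.
have {}hs : hd F1 F2 < 2 * s by rewrite lt_def eq_sym es.
have [C [T [e ff]]] := ex_focal_frame o1 o2.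
have [fC nT e0 _ _] := ff.
have es' : e <= s by move: hs; rewrite (hd_foci o1 o2 ff); lra.
have fil := hellipse_filled o1 o2 hs.
have [v1 v2] := vertex_in_hellipse o1 o2 ff es'.
apply: (SemimajorEllipse fil _ _ (min_hdisk_hellipse o1 o2 ff es')
  (hdiameter_vertices fC nT _)).
- by move=> x /hellipseP -/(_ o1 o2) [].
- move=> [c [r [] oc r0]]; rewrite hdisk_hellipse // => eS.
  have := focal_distance_unique o1 o2 oc oc (ltW hs) _ eS.
  rewrite hdvv // => /(_ (mulr_ge0 (ler0n _ 2) (ltW r0))).
  by move/(hd_eq0 o1 o2)/eqP; rewrite (negbTE F12).
- lra.
- exact: filled_ellipse_convex.
Qed.

(** Every constructor describes a set with a minimal disk of radius [s]: for the first
    three of them it is a degenerate or circular [hellipse]. This is what makes the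
    semi-axis a function of the set. *)
Lemma ordinary_semimajor_min_hdisk S s :
  ordinary_semimajor S s -> exists c, min_hdisk S c s.
Proof.
have key F1 F2 r : ordinary F1 -> ordinary F2 -> hd F1 F2 <= 2 * r ->
    exists c, min_hdisk (hellipse F1 F2 (2 * r)) c r.
  move=> o1 o2; have [C [T [e ff]]] := ex_focal_frame o1 o2.
  rewrite (hd_foci o1 o2 ff) => er; exists (pt C).
  by apply: min_hdisk_hellipse ff _ => //; lra.
case=> [c oc ->|a b r oa ob _ -> | c r oc r0 ->| c a b r _ _ _ h _ _].
- rewrite set1_hellipse //; have := key c c 0 oc oc.
  by rewrite hdvv // mulr0 => /(_ (lexx _)).
- rewrite hdistE // => -[h]; rewrite hsegment_hellipse // h.
  by apply: key => //; rewrite h.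
- by rewrite hdisk_hellipse //; apply: key => //; rewrite hdvv //; lra.
- by exists c.
Qed.

Lemma ordinary_semimajor_unique S s t :
  ordinary_semimajor S s -> ordinary_semimajor S t -> s = t.
Proof.
move=> /ordinary_semimajor_min_hdisk [c hc] /ordinary_semimajor_min_hdisk [d hd'].
by have [] := min_hdisk_unique hc hd'.
Qed.

End FilledEllipses.
(** * The range in coordinates *)

Section Shell.
Context {R : realType}.
Implicit Types (X Y P Q : R * R * R) (x y : R * R).
Implicit Types (a b c r t n p q u v m : R).

(** The coordinates in which the form [r n - t^2] becomes the Lorentz form; an operator
    observed at [x] gives [r = |Ax|^2], [t = Re <Ax, x>], [n = |x|^2]. *)
Definition obs r t n : R * R * R := ((r + n) / 2, t, (r - n) / 2).

(** The value of [obs] at a unit eigenvector of eigenvalue [a + i b]. As its square is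
    [b^2], it is time-like exactly when the eigenvalue is not real. *)
Definition eigvec a b : R * R * R := obs (a ^+ 2 + b ^+ 2) a 1.

Definition focus a b : R * R := pt (eigvec a b).

Lemma lor_eigvec a b a' b' :
  lor (eigvec a b) (eigvec a' b') = (b ^+ 2 + b' ^+ 2 + (a - a') ^+ 2) / 2.
Proof. by rewrite /lor /=; field. Qed.

Lemma eigvec_gt0 a b : 0 < (eigvec a b).1.1.
Proof.
by rewrite divr_gt0 // ltr_wpDl ?ltr01 // addr_ge0 // sqr_ge0.
Qed.

Definition unit_eigvec a b : R * R * R := comb `|b|^-1 (eigvec a b) 0 (eigvec a b).

Lemma future_eigvec a b : b != 0 -> future (unit_eigvec a b).
Proof.
move=> b0; split; first by rewrite /= mul0r addr0 mulr_gt0 ?invr_gt0 ?normr_gt0 ?eigvec_gt0.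
rewrite lor_combl !lor_combr !mul0r !addr0 lor_eigvec subrr -(real_normK (num_real b)).
by field; rewrite normr_eq0.
Qed.

Lemma focusE a b : b != 0 -> focus a b = pt (unit_eigvec a b).
Proof.
move=> b0; rewrite /focus /pt /unit_eigvec; have := eigvec_gt0 a b.
case: (eigvec a b) => [[x0 x1] x2] /= /gt_eqF/negbT n0.
by congr (_, _); field; rewrite normr_eq0 b0.
Qed.

Lemma ordinary_focus a b : b != 0 -> ordinary (focus a b).
Proof. by move=> b0; rewrite focusE //; exact/ordinary_pt/future_eigvec. Qed.

Lemma hyp_focus a b : b != 0 -> hyp (focus a b) = unit_eigvec a b.
Proof. by move=> b0; rewrite focusE // ptK //; exact: future_eigvec. Qed.

(** The range of the matrix with diagonal [a1 + i b1], [a2 + i b2] and with an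
    off-diagonal entry of squared modulus [c]; [p] and [q] stand for [|x1|^2] and
    [|x2|^2], and [u + i v] for the conjugate of that entry times [x1] times the
    conjugate of [x2]. *)
Definition shell a1 b1 a2 b2 c : set (R * R) :=
  [set x | exists p q u v, [/\ 0 <= p, 0 <= q, 0 < p + q,
     u ^+ 2 + v ^+ 2 = c * p * q &
     x = pt (obs ((a1 ^+ 2 + b1 ^+ 2) * p + (c + a2 ^+ 2 + b2 ^+ 2) * q
                  + 2 * (a1 * u - b1 * v))
                 (a1 * p + a2 * q + u) (p + q))]]%classic.

Lemma pt_lift x : pt (lift x) = x.
Proof. by case: x => x1 x2; rewrite /pt /lift /= !divr1. Qed.

Lemma shell_segment a1 b1 a2 b2 :
  shell a1 b1 a2 b2 0 = hsegment (focus a1 b1) (focus a2 b2).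
Proof.
have [l1 l2] := (eigvec_gt0 a1 b1, eigvec_gt0 a2 b2).
have obsE p q : obs ((a1 ^+ 2 + b1 ^+ 2) * p + (0 + a2 ^+ 2 + b2 ^+ 2) * q
   + 2 * (a1 * 0 - b1 * 0)) (a1 * p + a2 * q + 0) (p + q) =
   comb p (eigvec a1 b1) q (eigvec a2 b2).
  by rewrite /comb /obs /=; congr (_, _, _); field.
apply/seteqP; split=> x.
  move=> [p [q [u [v [p0 q0 pq]]]]]; rewrite !mul0r => uv ->.
  have /andP[/eqP u0 /eqP v0] : (u == 0) && (v == 0).
    by rewrite -(sqrf_eq0 u) -(sqrf_eq0 v) -paddr_eq0 ?sqr_ge0 // uv.
  subst u v; rewrite obsE; apply/hsegmentP => //.
  move: l1 l2; case: (eigvec a1 b1) (eigvec a2 b2) => [[x0 x1] x2] [[y0 y1] y2] /= l1 l2.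
  have d0 : 0 < p * x0 + q * y0.
    move: pq; rewrite lt_def paddr_eq0 // => /andP[]; rewrite negb_and => /orP[] h _.
      by rewrite ltr_wpDr ?mulr_ge0 ?mulr_gt0 // ?(ltW l2) // lt_def h.
    by rewrite ltr_wpDl ?mulr_ge0 ?mulr_gt0 // ?(ltW l1) // lt_def h.
  have dn : p * x0 + q * y0 != 0 by rewrite gt_eqF.
  exists (p / (p * x0 + q * y0)), (q / (p * x0 + q * y0)); split.
  - by rewrite divr_ge0 // ltW.
  - by rewrite divr_ge0 // ltW.
  - by rewrite /lift /pt /comb /=; congr (_, _, _); field.
move/hsegmentP => -/(_ l1 l2) [p [q [p0 q0 e]]].
exists p, q, 0, 0; split=> //.
- rewrite lt_def addr_ge0 // andbT; apply/eqP => pq.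
  have [p00 q00] : p = 0 /\ q = 0 by split; lra.
  by move: e; rewrite p00 q00 /lift /comb !mul0r addr0 => -[/eqP]; rewrite oner_eq0.
- by rewrite !mul0r expr0n /= addr0.
- by rewrite obsE -e pt_lift.
Qed.

(** The conic with the foci of the two eigenvalues, its denominators cleared. *)
Definition scaled_conic a1 b1 a2 b2 c Y : R :=
  let k := (b1 ^+ 2 + b2 ^+ 2 + (a1 - a2) ^+ 2 + c) / 2 in
  (k ^+ 2 - b1 ^+ 2 * b2 ^+ 2) * lor Y Y + b2 ^+ 2 * lor (eigvec a1 b1) Y ^+ 2
  + b1 ^+ 2 * lor (eigvec a2 b2) Y ^+ 2
  - 2 * k * lor (eigvec a1 b1) Y * lor (eigvec a2 b2) Y.

Lemma scaled_conicE a1 b1 a2 b2 c Y : b1 != 0 -> b2 != 0 ->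
  scaled_conic a1 b1 a2 b2 c Y = (b1 * b2) ^+ 2 *
  conic ((b1 ^+ 2 + b2 ^+ 2 + (a1 - a2) ^+ 2 + c) / 2 / (`|b1| * `|b2|))
    (unit_eigvec a1 b1) (unit_eigvec a2 b2) Y.
Proof.
move=> b10 b20; rewrite /scaled_conic /conic /unit_eigvec !lor_combl !mul0r !addr0.
rewrite [(b1 * b2) ^+ 2]exprMn -(real_normK (num_real b1)) -(real_normK (num_real b2)).
rewrite -normr_eq0 in b10; rewrite -normr_eq0 in b20.
move: (lor _ _) (lor _ _) (lor _ _) `|b1| `|b2| b10 b20 => q x y n1 n2 h1 h2.
by field; rewrite h1 h2.
Qed.

Lemma scaled_conic_scale a1 b1 a2 b2 c s Y Z :
  scaled_conic a1 b1 a2 b2 c (comb s Y 0 Z) = s ^+ 2 * scaled_conic a1 b1 a2 b2 c Y.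
Proof.
rewrite /scaled_conic lor_combl !lor_combr !mul0r !addr0.
by move: (lor _ _) (lor _ _) (lor _ _) => *; field.
Qed.

(** A quadratic polynomial has a perfect square as its discriminant when it has a root:
    here the polynomial of [shell_disc] in the unknown [q]. *)
Lemma scaled_conic_shell a1 b1 a2 b2 c p q u v : u ^+ 2 + v ^+ 2 = c * p * q ->
  scaled_conic a1 b1 a2 b2 c (obs ((a1 ^+ 2 + b1 ^+ 2) * p
     + (c + a2 ^+ 2 + b2 ^+ 2) * q + 2 * (a1 * u - b1 * v))
     (a1 * p + a2 * q + u) (p + q)) =
  (b1 * (c * (q - p) / 2 + u * (a1 - a2))
   + v * (((a1 - a2) ^+ 2 + b2 ^+ 2 - b1 ^+ 2 + c) / 2)) ^+ 2.
Proof.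
move=> e; set w := RHS.
transitivity (w + (((b1 ^+ 2 + b2 ^+ 2 + (a1 - a2) ^+ 2 + c) / 2) ^+ 2
                   - b1 ^+ 2 * b2 ^+ 2) * (c * p * q - (u ^+ 2 + v ^+ 2))).
  by rewrite /w /scaled_conic /lor /=; field.
by rewrite e subrr mulr0 addr0.
Qed.

(** For given [r], [t] and [n = 1] the equations for [u] and [v] are linear in [q], and
    the remaining condition [u^2 + v^2 = c (1 - q) q] is quadratic in [q]. Its
    discriminant is the conic. *)
Lemma shell_disc a1 b1 a2 b2 c r t : b1 != 0 ->
  let u1 := a1 - a2 in let u0 := t - a1 in
  let g := ((a1 - a2) ^+ 2 + b2 ^+ 2 - b1 ^+ 2 + c) / 2 in
  let h := a1 * (t - a1) - (r - a1 ^+ 2 - b1 ^+ 2) / 2 in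
  (b1 ^+ 2 * u0 * u1 + h * g - c * b1 ^+ 2 / 2) ^+ 2
  - (b1 ^+ 2 * u1 ^+ 2 + g ^+ 2 + c * b1 ^+ 2) * (b1 ^+ 2 * u0 ^+ 2 + h ^+ 2)
  = b1 ^+ 2 * scaled_conic a1 b1 a2 b2 c (obs r t 1).
Proof. by move=> b10 u1 u0 g h; rewrite /scaled_conic /lor /h /g /u0 /u1 /=; field. Qed.

Lemma lor_unit_eigvec a1 b1 a2 b2 : lor (unit_eigvec a1 b1) (unit_eigvec a2 b2) =
  (b1 ^+ 2 + b2 ^+ 2 + (a1 - a2) ^+ 2) / 2 / (`|b1| * `|b2|).
Proof.
rewrite lor_combl !lor_combr !mul0r !addr0 lor_eigvec invfM.
by move: (_ / 2) => k; ring.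
Qed.

Lemma hd_focus a1 b1 a2 b2 : b1 != 0 -> b2 != 0 ->
  hd (focus a1 b1) (focus a2 b2) =
  arcosh ((b1 ^+ 2 + b2 ^+ 2 + (a1 - a2) ^+ 2) / 2 / (`|b1| * `|b2|)).
Proof. by move=> b10 b20; rewrite /hd !hyp_focus // lor_unit_eigvec. Qed.

Lemma lift_scale X : X.1.1 != 0 -> lift (pt X) = comb X.1.1^-1 X 0 X.
Proof.
case: X => [[x0 x1] x2] /= n0; rewrite /lift /pt /comb /=.
by congr (_, _, _); field.
Qed.

Lemma pt_scale s X Z : s != 0 -> pt (comb s X 0 Z) = pt X.
Proof.
case: X => [[x0 x1] x2] s0; rewrite /pt /comb /= !mul0r !addr0.
by rewrite -!mulf_div divff // !mul1r.
Qed.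

(** The first coordinate of [obs] is half of [|Ax|^2 + |x|^2]. *)
Lemma obs_shell_gt0 a1 b1 a2 b2 c p q u v t :
  0 <= c -> 0 <= p -> 0 <= q -> 0 < p + q -> u ^+ 2 + v ^+ 2 = c * p * q ->
  0 < (obs ((a1 ^+ 2 + b1 ^+ 2) * p + (c + a2 ^+ 2 + b2 ^+ 2) * q
            + 2 * (a1 * u - b1 * v)) t (p + q)).1.1.
Proof.
move=> c0 p0 q0 pq uv; rewrite /= divr_gt0 // ltr_wpDl //.
have h2 : 0 <= (a2 ^+ 2 + b2 ^+ 2) * q by rewrite mulr_ge0 // addr_ge0 // sqr_ge0.
suff : 0 <= (a1 ^+ 2 + b1 ^+ 2) * p + c * q + 2 * (a1 * u - b1 * v) by lra.
have [p00|pn] := eqVneq p 0.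
  have /andP[/eqP u0 /eqP v0] : (u == 0) && (v == 0).
    by rewrite -(sqrf_eq0 u) -(sqrf_eq0 v) -paddr_eq0 ?sqr_ge0 // uv p00 mulr0 mul0r.
  by rewrite p00 u0 v0 !mulr0 subrr mulr0 addr0 add0r mulr_ge0.
have {p0}pn : 0 < p by rewrite lt_def pn.
rewrite -(pmulr_rge0 _ pn).
have -> : p * ((a1 ^+ 2 + b1 ^+ 2) * p + c * q + 2 * (a1 * u - b1 * v))
  = (a1 * p + u) ^+ 2 + (b1 * p - v) ^+ 2 + (c * p * q - (u ^+ 2 + v ^+ 2)) by ring.
by rewrite uv subrr addr0 addr_ge0 ?sqr_ge0.
Qed.

(** A real root [q] of the quadratic equation lies in the unit interval automatically,
    since [c (1 - q) q] is a sum of two squares there. *)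
Lemma shell_conic a1 b1 a2 b2 c : b1 != 0 -> b2 != 0 -> 0 < c ->
  shell a1 b1 a2 b2 c =
  [set x | 0 <= conic ((b1 ^+ 2 + b2 ^+ 2 + (a1 - a2) ^+ 2 + c) / 2 / (`|b1| * `|b2|))
                      (hyp (focus a1 b1)) (hyp (focus a2 b2)) (lift x)]%classic.
Proof.
move=> b10 b20 c0; rewrite !hyp_focus //.
have bb : 0 < `|b1| * `|b2| by rewrite mulr_gt0 ?normr_gt0.
have sb : 0 < (b1 * b2) ^+ 2 by rewrite -real_normK ?num_real // normrM exprn_gt0.
have [f1 f2] := (future_eigvec a1 b10, future_eigvec a2 b20).
have km : lor (unit_eigvec a1 b1) (unit_eigvec a2 b2) <
    (b1 ^+ 2 + b2 ^+ 2 + (a1 - a2) ^+ 2 + c) / 2 / (`|b1| * `|b2|).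
  by rewrite lor_unit_eigvec !ltr_pM2r ?invr_gt0 // ltrDl.
apply/seteqP; split=> x /=; rewrite -(pmulr_rge0 _ sb) -scaled_conicE //.
  move=> [p [q [u [v [p0 q0 pq uv ->]]]]]; set X := obs _ _ _.
  have X0 : X.1.1 != 0 by rewrite gt_eqF //; apply: obs_shell_gt0 => //; exact: ltW.
  by rewrite lift_scale // scaled_conic_scale scaled_conic_shell // mulr_ge0 // sqr_ge0.
move=> hc; have ox : ordinary x.
  apply: (ordinary_of_conic f1 f2 km).
  by rewrite -(pmulr_rge0 _ sb) -scaled_conicE.
case: x ox hc => x1 x2; rewrite /ordinary /dotp /= => ox hc.
have d0 : 0 < 1 - x2.
  by have := sqr_ge0 x1; have := sqr_ge0 (x2 + 1); nra.
have dn : 1 - x2 != 0 by rewrite gt_eqF.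
set r := (1 + x2) / (1 - x2); set t := x1 / (1 - x2).
have eX : lift (x1, x2) = comb (1 - x2) (obs r t 1) 0 (obs r t 1).
  by rewrite /lift /comb /obs /r /t /=; congr (_, _, _); field.
move: hc; rewrite eX scaled_conic_scale pmulr_rge0 ?exprn_gt0 // => hc.
(* With [n = 1] and [p = 1 - q] one gets [u = u0 + u1 q] and [b1 v = h + g q]; the
   equation times [b1^2] is [A q^2 + 2 B q + D = 0]. *)
pose u1 := a1 - a2; pose u0 := t - a1.
pose g := ((a1 - a2) ^+ 2 + b2 ^+ 2 - b1 ^+ 2 + c) / 2.
pose h := a1 * (t - a1) - (r - a1 ^+ 2 - b1 ^+ 2) / 2.
pose A := b1 ^+ 2 * u1 ^+ 2 + g ^+ 2 + c * b1 ^+ 2.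
pose B := b1 ^+ 2 * u0 * u1 + h * g - c * b1 ^+ 2 / 2.
pose D := b1 ^+ 2 * u0 ^+ 2 + h ^+ 2.
have disc : 0 <= B ^+ 2 - A * D.
  have -> : B ^+ 2 - A * D = b1 ^+ 2 * scaled_conic a1 b1 a2 b2 c (obs r t 1).
    exact: shell_disc.
  by rewrite mulr_ge0 ?sqr_ge0.
have A0 : 0 < A.
  have cb : 0 < c * b1 ^+ 2 by rewrite mulr_gt0 // exprn_even_gt0.
  by rewrite /A -exprMn ltr_wpDl // addr_ge0 // sqr_ge0.
set s := Num.sqrt (B ^+ 2 - A * D).
have s2 : s ^+ 2 = B ^+ 2 - A * D by rewrite sqr_sqrtr.
set q := (s - B) / A.
have An : A != 0 by rewrite gt_eqF.
have root : A * q ^+ 2 + 2 * B * q + D = 0.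
  by rewrite /q; move: (A) (s) An s2 => A' s' An s2; field: s2.
have uv : (u0 + u1 * q) ^+ 2 + ((h + g * q) / b1) ^+ 2 = c * (1 - q) * q.
  apply: (mulfI (_ : b1 ^+ 2 != 0)); first by rewrite sqrf_eq0.
  apply/eqP; rewrite -subr_eq0 -root /A /B /D; apply/eqP.
  by move: (h) (g) (u0) (u1) (q) => *; field.
have q01 : 0 <= (1 - q) * q.
  by rewrite -(pmulr_rge0 _ c0) mulrA -uv addr_ge0 ?sqr_ge0.
have [q0 q1] : 0 <= q /\ 0 <= 1 - q by split; nra.
exists (1 - q), q, (u0 + u1 * q), ((h + g * q) / b1); split=> //.
  by rewrite subrK.
transitivity (pt (obs r t 1)).
  by rewrite -[LHS]pt_lift eX pt_scale.
congr pt; rewrite /obs /u0 /u1 /g /h; move: (q) (r) (t) => ? ? ?.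
by congr (_, _, _); field.
Qed.

(** For [c > 0] the conic of [shell_conic] is that of a proper ellipse; for [c = 0] the
    operator is normal and the range is the segment between the foci. *)
Lemma shell_hellipse a1 b1 a2 b2 c (s : R) : b1 != 0 -> b2 != 0 -> 0 <= c ->
  s = arcosh ((b1 ^+ 2 + b2 ^+ 2 + (a1 - a2) ^+ 2 + c) / 2 / (`|b1| * `|b2|)) / 2 ->
  shell a1 b1 a2 b2 c = hellipse (focus a1 b1) (focus a2 b2) (2 * s) /\
  hd (focus a1 b1) (focus a2 b2) <= 2 * s.
Proof.
move=> b10 b20 c0 ->; set m := arcosh _.
have -> : 2 * (m / 2) = m by field.
have fo1 := ordinary_focus a1 b10; have fo2 := ordinary_focus a2 b20.
have [f1 f2] := (future_eigvec a1 b10, future_eigvec a2 b20).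
have := lor_ge1 f1 f2; rewrite lor_unit_eigvec => k1.
have bb : 0 < `|b1| * `|b2| by rewrite mulr_gt0 ?normr_gt0.
move: c0; rewrite le_eqVlt => /orP[/eqP c0|c0].
  have dm : hd (focus a1 b1) (focus a2 b2) = m.
    by rewrite hd_focus // /m -c0 addr0.
  by rewrite dm lexx -dm -c0 shell_segment hsegment_hellipse.
have km : (b1 ^+ 2 + b2 ^+ 2 + (a1 - a2) ^+ 2) / 2 / (`|b1| * `|b2|) <
    (b1 ^+ 2 + b2 ^+ 2 + (a1 - a2) ^+ 2 + c) / 2 / (`|b1| * `|b2|).
  by rewrite !ltr_pM2r ?invr_gt0 // ltrDl.
have k1' := ltW (le_lt_trans k1 km).
have dm : hd (focus a1 b1) (focus a2 b2) < m.
  rewrite ltNge -ler_cosh ?nnegrE ?hd_ge0 ?arcosh_ge0 // -ltNge.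
  by rewrite cosh_hd // !hyp_focus // lor_unit_eigvec arcoshK.
by split; [rewrite hellipse_conic // arcoshK // shell_conic | exact: ltW].
Qed.

Lemma asymptotic_pt X : X.1.1 != 0 -> asymptotic (pt X) <-> lor X X = 0.
Proof.
move=> X0; have := lor_pt X0 X0; rewrite /asymptotic => e; split=> [/eqP h|h].
  move: e; rewrite h subrr => /esym/eqP; rewrite mulf_eq0 invr_eq0 mulf_eq0.
  by rewrite (negbTE X0) !orbF => /eqP.
by move: e; rewrite h mul0r => /eqP; rewrite subr_eq0 eq_sym.
Qed.

(** The two basis vectors give points of the range; their being one and the same point
    of the unit circle forces equal real eigenvalues and [c = 0]. *)
Lemma shell_asymptotic a1 b1 a2 b2 c : 0 <= c ->
  (exists2 v, asymptotic v & shell a1 b1 a2 b2 c = [set v]%classic) <->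
  b1 ^+ 2 + b2 ^+ 2 + (a1 - a2) ^+ 2 + c = 0.
Proof.
move=> c0; have [p1 p2] := (eigvec_gt0 a1 b1, eigvec_gt0 a2 b2).
split=> [[v av sv]|K0]; last first.
  have := sqr_ge0 b1; have := sqr_ge0 b2; have := sqr_ge0 (a1 - a2) => h3 h2 h1.
  have [/eqP e1 /eqP e2 /eqP e3 {}c0] : [/\ b1 ^+ 2 = 0, b2 ^+ 2 = 0,
      (a1 - a2) ^+ 2 = 0 & c = 0] by split; lra.
  move: e1 e2 e3; rewrite !sqrf_eq0 subr_eq0 => /eqP e1 /eqP e2 /eqP e3.
  subst b1 b2 a1 c; exists (focus a2 0); last by rewrite shell_segment hsegment_refl.
  apply/asymptotic_pt; first by rewrite gt_eqF // eigvec_gt0.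
  by rewrite lor_eigvec subrr expr0n /= !addr0 mul0r.
have in1 : shell a1 b1 a2 b2 c (focus a1 b1).
  exists 1, 0, 0, 0; split; rewrite ?addr0 ?ler01 ?ltr01 ?mulr0 ?expr0n ?addr0 //.
  by rewrite subrr !mulr0 !mulr1 !addr0 /focus /eigvec.
have in2 : shell a1 b1 a2 b2 c (pt (obs (c + a2 ^+ 2 + b2 ^+ 2) a2 1)).
  exists 0, 1, 0, 0; split; rewrite ?add0r ?ler01 ?ltr01 ?mulr0 ?mul0r ?expr0n ?addr0 //.
  by rewrite subrr !mulr0 !mulr1 !addr0 !add0r.
move: in1 in2; rewrite sv /= => in1 in2.
have p3 : (obs (c + a2 ^+ 2 + b2 ^+ 2) a2 1).1.1 != 0.
  by rewrite gt_eqF // divr_gt0 // ltr_wpDl ?ltr01 // !addr_ge0 // sqr_ge0.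
have e1 : b1 ^+ 2 = 0.
  have : asymptotic (focus a1 b1) by rewrite in1.
  by move/asymptotic_pt => -/(_ (lt0r_neq0 p1)); rewrite lor_eigvec subrr; lra.
have e2 : c + b2 ^+ 2 = 0.
  have : asymptotic (pt (obs (c + a2 ^+ 2 + b2 ^+ 2) a2 1)) by rewrite in2.
  by move/asymptotic_pt => -/(_ p3); rewrite /lor /=; lra.
have := lor_pt (lt0r_neq0 p1) p3; rewrite -/(focus a1 b1) in1 in2.
move: av; rewrite /asymptotic => /eqP ->; rewrite subrr => /esym/eqP.
rewrite mulf_eq0 invr_eq0 mulf_eq0 (negbTE p3) (negbTE (lt0r_neq0 p1)) !orbF /lor /=.
move=> /eqP; have := sqr_ge0 b2; lra.
Qed.

End Shell.
(** * Triangularization and invariants of an operator *)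

Section Schur.
Local Open Scope complex_scope.
Context {R : realType} {V : vectType R[i]} (dot : {dot V for Num.conj}).
Hypothesis dimV : \dim {:V} = 2%N.
Implicit Types (A T : 'End(V)) (e x y v : V) (l c : R[i]).

Lemma dot_conj x y : dot x y = Num.conj (dot y x).
Proof. by rewrite hermC expr0 mul1r. Qed.

Lemma dotDl x y v : dot (x + y) v = dot x v + dot y v.
Proof. exact: linearDl. Qed.

Lemma dotDr x y v : dot v (x + y) = dot v x + dot v y.
Proof. exact: linearD. Qed.

Lemma dotZl l x v : dot (l *: x) v = l * dot x v.
Proof. exact: linearZl_LR. Qed.

Lemma dotZr l x v : dot v (l *: x) = Num.conj l * dot v x.
Proof. exact: linearZ. Qed.

Definition onb e1 e2 : Prop := [/\ dot e1 e1 = 1, dot e2 e2 = 1 & dot e1 e2 = 0].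

Lemma onb_basis e1 e2 : onb e1 e2 ->
  exists2 t : (\dim {:V}).-tuple V, basis_of {:V} t & tval t = [:: e1; e2].
Proof.
move=> [d1 d2 d12]; exists (tcast (esym dimV) [tuple e1; e2]); last by rewrite val_tcast.
rewrite val_tcast basisEfree subvf dimV leqnn !andbT.
apply: (@orthonormal_free _ _ dot); apply/orthonormal2P.
by split.
Qed.

Lemma onb_coord e1 e2 (t : (\dim {:V}).-tuple V) : onb e1 e2 -> basis_of {:V} t ->
  tval t = [:: e1; e2] -> forall j x, coord t j x = dot x t`_j.
Proof.
move=> [d1 d2 d12] bt te j x.
have d21 : dot e2 e1 = 0 by rewrite dot_conj d12 conjC0.
have tt i : (i < 2)%N -> dot t`_i t`_j = (i == j :> nat)%:R.
  move=> i2; have := ltn_ord j; rewrite [X in (_ < X)%N -> _]dimV te.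
  by case: i i2 => [|[|//]] _; case: (nat_of_ord j) => [|[|//]] /=.
rewrite [in RHS](coord_basis bt (memvf x)) linear_sumlz /= (bigD1 j) //=.
rewrite dotZl tt -?[X in (_ < X)%N]dimV // eqxx mulr1 big1 ?addr0 // => i.
rewrite -val_eqE /= => ij; by rewrite dotZl tt -?[X in (_ < X)%N]dimV // (negbTE ij) mulr0.
Qed.

Lemma onb_expand e1 e2 x : onb e1 e2 -> x = dot x e1 *: e1 + dot x e2 *: e2.
Proof.
move=> o; have [t bt te] := onb_basis o.
rewrite {1}(coord_basis bt (memvf x)).
under eq_bigr do rewrite (onb_coord o bt te) te.
rewrite -(big_mkord xpredT (fun i => dot x [:: e1; e2]`_i *: [:: e1; e2]`_i)) dimV.
by rewrite !big_nat_recr //= big_nil add0r.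
Qed.

Lemma opmx_conj (t : (\dim {:V}).-tuple V) : basis_of {:V} t ->
  exists P Q : 'M[R[i]]_(\dim {:V}), P *m Q = 1%:M /\
  forall A, opmx A = P *m passmx.mxof t t A *m Q.
Proof.
move=> bt; set b := vbasis {:V}; have bb : basis_of {:V} b := vbasisP _.
exists (passmx.mxof b t \1), (passmx.mxof t b \1); split.
  rewrite -passmx.mxof_comp // comp_lfun1l passmx.mxof1 //; exact: basis_free bb.
by move=> A; rewrite -!passmx.mxof_comp // comp_lfun1l comp_lfun1r.
Qed.

Lemma onb_mxE e1 e2 (t : (\dim {:V}).-tuple V) : onb e1 e2 -> basis_of {:V} t ->
  tval t = [:: e1; e2] ->
  forall A i j, passmx.mxof t t A i j = dot (A t`_i) t`_j.
Proof.
move=> o bt te A i j.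
by rewrite !mxE /= passmx.vecof_delta (onb_coord o bt te).
Qed.

Lemma optr_onb e1 e2 A : onb e1 e2 -> optr A = dot (A e1) e1 + dot (A e2) e2.
Proof.
move=> o; have [t bt te] := onb_basis o; have [P [Q [PQ conjE]]] := opmx_conj bt.
rewrite /optr conjE mxtrace_mulC mulmxA (mulmx1C PQ) mul1mx /mxtrace.
under eq_bigr do rewrite (onb_mxE o bt te) te.
rewrite -(big_mkord xpredT (fun i => dot (A [:: e1; e2]`_i) [:: e1; e2]`_i)) dimV.
by rewrite !big_nat_recr //= big_nil add0r.
Qed.

Definition schur_form A e1 e2 (l1 c l2 : R[i]) : Prop :=
  [/\ onb e1 e2, A e1 = l1 *: e1 & A e2 = c *: e1 + l2 *: e2].

Lemma schur_trig A e1 e2 l1 c l2 : schur_form A e1 e2 l1 c l2 ->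
  opdet A = l1 * l2 /\ char_poly (opmx A) = ('X - l1%:P) * ('X - l2%:P).
Proof.
move=> [] o A1 A2; have [t bt te] := onb_basis o.
have [P [Q [PQ conjE]]] := opmx_conj bt.
have [d1 d2 d12] := o; have d21 : dot e2 e1 = 0 by rewrite dot_conj d12 conjC0.
have trig : is_trig_mx (passmx.mxof t t A).
  apply/is_trig_mxP => i j ij; rewrite (onb_mxE o bt te) te.
  have := ltn_ord j; rewrite [X in (_ < X)%N -> _]dimV.
  case: (nat_of_ord j) ij => [|[|//]]; case: (nat_of_ord i) => [|[|//]] //= _ _.
  by rewrite A1 dotZl d12 mulr0.
have E1 : dot (A e1) e1 = l1 by rewrite A1 dotZl d1 mulr1.
have E2 : dot (A e2) e2 = l2 by rewrite A2 dotDl !dotZl d12 d2 mulr0 add0r mulr1.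
split.
  rewrite /opdet conjE !det_mulmx mulrAC -det_mulmx PQ det1 mul1r det_trig //.
  under eq_bigr do rewrite (onb_mxE o bt te) te.
  rewrite -(big_mkord xpredT (fun i => dot (A [:: e1; e2]`_i) [:: e1; e2]`_i)) dimV.
  by rewrite !big_nat_recr //= big_nil mul1r E1 E2.
have -> : char_poly (opmx A) = char_poly (passmx.mxof t t A).
  rewrite /char_poly conjE /char_poly_mx.
  have PQp : map_mx polyC P *m map_mx polyC Q = 1%:M by rewrite -map_mxM PQ map_mx1.
  have -> : 'X%:M - map_mx polyC (P *m passmx.mxof t t A *m Q) =
      map_mx polyC P *m ('X%:M - map_mx polyC (passmx.mxof t t A)) *m map_mx polyC Q.
    rewrite mulmxBr mulmxBl !map_mxM; congr (_ - _).
    by rewrite mul_mx_scalar -scalemxAl PQp scalemx1.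
  by rewrite !det_mulmx mulrAC -det_mulmx PQp det1 mul1r.
rewrite char_poly_trig //.
under eq_bigr do rewrite (onb_mxE o bt te) te.
rewrite -(big_mkord xpredT (fun i => 'X - (dot (A [:: e1; e2]`_i) [:: e1; e2]`_i)%:P)) dimV.
by rewrite !big_nat_recr //= big_nil mul1r E1 E2.
Qed.

Lemma leigenvalueE A l : passmx.leigenvalue A l = root (char_poly (opmx A)) l.
Proof.
have bb : basis_of {:V} (vbasis {:V}) := vbasisP _.
rewrite /passmx.leigenvalue (passmx.leigenspaceE bb) passmx.vsof_eq0 //.
by rewrite -eigenvalue_root_char.
Qed.

Lemma dotr_neq0 x : x != 0 -> exists k, dot (k *: x) (k *: x) = 1 /\ k != 0.
Proof.
move=> x0; have d0 : 0 < dot x x by rewrite dnorm_gt0.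
have s0 : 0 < sqrtC (dot x x) by rewrite sqrtC_gt0.
exists (sqrtC (dot x x))^-1; split; last by rewrite invr_eq0 gt_eqF.
rewrite dotZl dotZr geC0_conj ?invr_ge0 ?ltW //.
by rewrite mulrA -invfM -expr2 sqrtCK mulVf // gt_eqF.
Qed.

(** A unit eigenvector exists because the scalars are algebraically closed; it is
    completed to an orthonormal basis. *)
Lemma ex_schur A : exists e1 e2 l1 c l2, schur_form A e1 e2 l1 c l2.
Proof.
have [l1 rl] : exists l, root (char_poly (opmx A)) l.
  by apply/closed_rootP; rewrite size_char_poly dimV.
have : passmx.leigenvalue A l1 by rewrite leigenvalueE.
move=> nz; have := memv_pick (passmx.leigenspace A l1).
rewrite /passmx.leigenspace memv_ker; set v := vpick _ => /eqP Av.
have v0 : v != 0 by rewrite vpick0.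
have {}Av : A v = l1 *: v.
  by move: Av; rewrite add_lfunE opp_lfunE scale_lfunE id_lfunE => /eqP;
    rewrite subr_eq0 => /eqP.
have [k [ke k0]] := dotr_neq0 v0.
set e1 := k *: v in ke.
have A1 : A e1 = l1 *: e1 by rewrite linearZ /= Av !scalerA mulrC.
have [w wn] : exists w, w \notin <[e1]>%VS.
  apply: contrapT => h; have : (fullv <= <[e1]>)%VS.
    by apply/subvP => w _; apply: contrapT => /negP hw; apply: h; exists w.
  by move/dimvS; rewrite dimV dim_vline; case: (e1 != 0).
pose u := w - dot w e1 *: e1.
have u0 : u != 0.
  apply: contra wn; rewrite subr_eq0 => /eqP ->.
  by rewrite memvZ // memv_line.
have ue : dot e1 u = 0.
  have -> : dot e1 u = Num.conj (dot u e1) by exact: dot_conj.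
  by rewrite /u linearBl /= dotZl ke mulr1 subrr conjC0.
have [j [je j0]] := dotr_neq0 u0.
have o : onb e1 (j *: u) by split => //; rewrite dotZr ue mulr0.
exists e1, (j *: u), l1, (dot (A (j *: u)) e1), (dot (A (j *: u)) (j *: u)).
by split=> //; exact: onb_expand.
Qed.

Lemma optr_adjoint A e1 e2 : onb e1 e2 ->
  optr (adjoint dot A \o A)%VF = dot (A e1) (A e1) + dot (A e2) (A e2).
Proof.
move=> o; rewrite (optr_onb _ o) !comp_lfunE.
have h x y : dot (adjoint dot A x) y = dot x (A y).
  by rewrite dot_conj -(adjointP dot A) -dot_conj.
by rewrite !h.
Qed.

End Schur.
(** * The conformal range of a triangularized operator *)

Section ConformalRange.
Local Open Scope complex_scope.
Context {R : realType} {V : vectType R[i]} (dot : {dot V for Num.conj}).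
Hypothesis dimV : \dim {:V} = 2%N.
Implicit Types (A : 'End(V)) (e x y v : V) (l c z : R[i]).

Definition sqc z : R := complex.Re z ^+ 2 + complex.Im z ^+ 2.

Lemma pt_obs (r t n : R) : pt (obs r t n) = (2 * t / (r + n), (r - n) / (r + n)).
Proof.
have h (k j : R) : k / (j / 2) = 2 * k / j by rewrite invf_div mulrA (mulrC k).
by rewrite /pt /obs /= !h [2 * (_ / 2)]mulrC divfK.
Qed.

Lemma conjcE z : Num.conj z = conjc z.
Proof. by []. Qed.

Lemma mulc_conj z : z * Num.conj z = (sqc z)%:C.
Proof. by case: z => a b; rewrite conjcE /sqc /=; simpc; congr (_ +i* _); ring. Qed.

Lemma cabs_sqr z : cabs z ^+ 2 = sqc z.
Proof.
by rewrite /cabs normc_def /= sqr_sqrtr // addr_ge0 // sqr_ge0.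
Qed.

Lemma dot_onb e1 e2 l1 l2 z1 z2 : onb dot e1 e2 ->
  dot (l1 *: e1 + l2 *: e2) (z1 *: e1 + z2 *: e2) =
  l1 * Num.conj z1 + l2 * Num.conj z2.
Proof.
move=> [d1 d2 d12]; have d21 : dot e2 e1 = 0 by rewrite dot_conj d12 conjC0.
by rewrite !dotDl !dotDr !dotZl !dotZr d1 d2 d12 d21; ring.
Qed.

Lemma sqn_onb e1 e2 l1 l2 : onb dot e1 e2 ->
  sqn dot (l1 *: e1 + l2 *: e2) = sqc l1 + sqc l2.
Proof. by move=> o; rewrite /sqn dot_onb // !mulc_conj. Qed.

(** Every pair of values of [p], [q] and [u + i v] allowed by [shell] comes from a
    vector: take [x2] real, and solve for [x1]. *)
Lemma conformal_range_shell A e1 e2 l1 c l2 : schur_form dot A e1 e2 l1 c l2 ->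
  conformal_range dot A =
  shell (complex.Re l1) (complex.Im l1) (complex.Re l2) (complex.Im l2) (sqc c).
Proof.
move=> [] o A1 A2.
have AE (x1 x2 : R[i]) : A (x1 *: e1 + x2 *: e2) = (l1 * x1 + c * x2) *: e1 + (l2 * x2) *: e2.
  rewrite linearD !linearZ /= A1 A2 scalerDr !scalerA addrA -scalerDl.
  by rewrite (mulrC x1) (mulrC x2 c) (mulrC x2).
have ptE (x1 x2 : R[i]) : let x := x1 *: e1 + x2 *: e2 in let w := Num.conj c * x1 * Num.conj x2 in
    (2 * complex.Re (dot (A x) x) / (sqn dot (A x) + sqn dot x),
     (sqn dot (A x) - sqn dot x) / (sqn dot (A x) + sqn dot x)) =
    pt (obs (sqc l1 * sqc x1 + (sqc c + complex.Re l2 ^+ 2 + complex.Im l2 ^+ 2) * sqc x2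
       + 2 * (complex.Re l1 * complex.Re w - complex.Im l1 * complex.Im w))
      (complex.Re l1 * sqc x1 + complex.Re l2 * sqc x2 + complex.Re w)
      (sqc x1 + sqc x2)).
  rewrite /= AE dot_onb // !sqn_onb // -pt_obs; congr (pt (obs _ _ _)).
    case: l1 c l2 x1 x2 {A1 A2 AE} => [? ?] [? ?] [? ?] [? ?] [? ?].
    by rewrite !conjcE /sqc /=; ring.
  case: l1 c l2 x1 x2 {A1 A2 AE} => [? ?] [? ?] [? ?] [? ?] [? ?].
  by rewrite !conjcE /sqc /=; ring.
have sqw (x1 x2 : R[i]) : sqc (Num.conj c * x1 * Num.conj x2) = sqc c * sqc x1 * sqc x2.
  case: (c) x1 x2 => [? ?] [? ?] [? ?].
  by rewrite !conjcE /sqc /=; ring.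
have sqc_ge0 z : 0 <= sqc z by rewrite addr_ge0 ?sqr_ge0.
apply/seteqP; split=> P /=.
  move=> [x x0 ->]; have ex := onb_expand dimV x o.
  exists (sqc (dot x e1)), (sqc (dot x e2)),
    (complex.Re (Num.conj c * dot x e1 * Num.conj (dot x e2))),
    (complex.Im (Num.conj c * dot x e1 * Num.conj (dot x e2))); split=> //.
  - have : 0 < dot x x by rewrite dnorm_gt0.
    rewrite {1 2}ex dot_onb // !mulc_conj -rmorphD /=.
    by rewrite -[X in X < _]/((0 : R)%:C) ltcR.
  - exact: sqw.
  - by have := ptE (dot x e1) (dot x e2); rewrite /= -ex.
move=> [p [q [u [v [p0 q0 pq uv ->]]]]].
have [x1 [x2 [X1 X2 [ReW ImW]]]] : exists x1 x2 : R[i], [/\ sqc x1 = p, sqc x2 = q &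
    complex.Re (Num.conj c * x1 * Num.conj x2) = u /\
    complex.Im (Num.conj c * x1 * Num.conj x2) = v].
  have [cq0|cqn] := eqVneq (sqc c * q) 0.
    have /andP[/eqP u0 /eqP v0] : (u == 0) && (v == 0).
      rewrite -(sqrf_eq0 u) -(sqrf_eq0 v) -paddr_eq0 ?sqr_ge0 // uv.
      by rewrite mulrAC cq0 mul0r.
    have h : sqc (Num.conj c * (Num.sqrt p)%:C * Num.conj ((Num.sqrt q)%:C)) = 0.
      rewrite sqw /sqc /= !sqr_sqrtr // expr0n /= !addr0 mulrAC.
      by rewrite -/(sqc c) cq0 mul0r.
    exists (Num.sqrt p)%:C, (Num.sqrt q)%:C; split.
    - by rewrite /sqc /= sqr_sqrtr // expr0n addr0.
    - by rewrite /sqc /= sqr_sqrtr // expr0n addr0.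
    move/eqP: h; rewrite paddr_eq0 ?sqr_ge0 // !sqrf_eq0 u0 v0.
    by move=> /andP[/eqP -> /eqP ->].
  have [cn qn] : sqc c != 0 /\ q != 0.
    by move: cqn; rewrite mulf_eq0 negb_or => /andP[].
  set s := Num.sqrt q.
  have s2 : q = s ^+ 2 by rewrite sqr_sqrtr.
  have sn : s != 0 by rewrite -sqrf_eq0 -s2.
  exists (((u * complex.Re c - v * complex.Im c) / (sqc c * s))
          +i* ((u * complex.Im c + v * complex.Re c) / (sqc c * s))), s%:C.
  rewrite s2 {s2 cqn qn} in uv *.
  move: uv cn; rewrite conjcE; case: (c) => c1 c2; rewrite /sqc /= => uv cn.
  split.
  - transitivity ((u ^+ 2 + v ^+ 2) / ((c1 ^+ 2 + c2 ^+ 2) * s ^+ 2)).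
      by field; rewrite cn sn.
    by rewrite uv; field; rewrite cn sn.
  - by rewrite expr0n addr0.
  - by split; field; rewrite cn sn.
exists (x1 *: e1 + x2 *: e2).
  rewrite -(dnorm_gt0 dot) dot_onb // !mulc_conj -rmorphD /= X1 X2.
  by rewrite -[X in X < _]/((0 : R)%:C) ltcR.
by rewrite /= ptE X1 X2 ReW ImW.
Qed.

(** With [z = (l1 - l2) / 2] one has [D_ A = - z^2], so that everything is a polynomial
    in the real and imaginary parts of the triangular entries. *)
Lemma invariants_schur A e1 e2 l1 c l2 : schur_form dot A e1 e2 l1 c l2 ->
  [/\ E_ A - cabs (D_ A) = complex.Im l1 * complex.Im l2,
      E_ A + cabs (D_ A) = (complex.Im l1 ^+ 2 + complex.Im l2 ^+ 2
                            + (complex.Re l1 - complex.Re l2) ^+ 2) / 2 &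
      U_ dot A + E_ A = (complex.Im l1 ^+ 2 + complex.Im l2 ^+ 2
                         + (complex.Re l1 - complex.Re l2) ^+ 2 + sqc c) / 2].
Proof.
move=> sf; have [] := sf => o A1 A2.
have [d1 d2 d12] := o; have d21 : dot e2 e1 = 0 by rewrite dot_conj d12 conjC0.
have [detE _] := schur_trig dimV sf.
have trE : optr A = l1 + l2.
  by rewrite (optr_onb dimV _ o) A1 A2 dotDl !dotZl d1 d2 d12 mulr0 add0r !mulr1.
have trAA : optr (adjoint dot A \o A)%VF = (sqc l1 + sqc c + sqc l2)%:C.
  rewrite (optr_adjoint dimV _ o) A1 A2.
  have -> : l1 *: e1 = l1 *: e1 + 0 *: e2 by rewrite scale0r addr0.
  have sqc0 : sqc (0 : R[i]) = 0 by rewrite /sqc /= expr0n addr0.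
  by rewrite !dot_onb // !mulc_conj sqc0 -!rmorphD /= addr0 addrA.
pose z := (l1 - l2) / 2.
have DE : D_ A = - (z ^+ 2).
  by rewrite /D_ detE trE /z; field.
have cD : cabs (D_ A) = sqc z by rewrite /cabs DE normrN normrX -add_Re2_Im2.
have zE : z = ((complex.Re l1 - complex.Re l2) / 2)
              +i* ((complex.Im l1 - complex.Im l2) / 2).
  have two : (2 : R[i])^-1 = ((2 : R)^-1)%:C by rewrite fmorphV rmorph_nat.
  rewrite /z two; case: (l1) (l2) => a1 b1 [a2 b2].
  by simpc; congr (_ +i* _); ring.
have reD : complex.Re (D_ A) = complex.Im z ^+ 2 - complex.Re z ^+ 2.
  by rewrite DE; case: (z) => a b /=; ring.
rewrite /E_ /U_ cD reD trE trAA cabs_sqr zE /sqc.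
case: (l1) (l2) (c) => a1 b1 [a2 b2] [c1 c2] /=.
by split; field.
Qed.

End ConformalRange.
(** * Semi-axis and focal distance *)

Section Main.
Local Open Scope complex_scope.
Context {R : realType} {V : vectType R[i]} (dot : {dot V for Num.conj}).
Hypothesis dimV : \dim {:V} = 2%N.
Implicit Types (A : 'End(V)) (y : \bar R).

Lemma leigenvalue_schur A e1 e2 l1 c l2 : schur_form dot A e1 e2 l1 c l2 ->
  forall l, passmx.leigenvalue A l = (l == l1) || (l == l2).
Proof.
move=> sf l; have [_ cp] := schur_trig dimV sf.
by rewrite leigenvalueE cp rootM !root_XsubC.
Qed.

Lemma real_complex_eq (l : R[i]) : (exists r : R, r%:C = l) <-> complex.Im l = 0.
Proof.
split=> [[r <-] //|h]; exists (complex.Re l).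
by case: l h => a b /= ->.
Qed.

Lemma has_real_eigenvalue_schur A e1 e2 l1 c l2 : schur_form dot A e1 e2 l1 c l2 ->
  has_real_eigenvalue A <-> complex.Im l1 * complex.Im l2 = 0.
Proof.
move=> sf; split.
  move=> [r]; rewrite (leigenvalue_schur sf) => /orP[] /eqP <- /=;
    by rewrite ?mulr0 ?mul0r.
move/eqP; rewrite mulf_eq0 => /orP[] /eqP /real_complex_eq [r h]; exists r;
  by rewrite (leigenvalue_schur sf) h eqxx ?orbT.
Qed.

Lemma major_semiaxisE A y : major_semiaxis dot A y <->
  y = ((2^-1)%:E * earcosh (equot (U_ dot A + E_ A)%R `|E_ A - cabs (D_ A)|%R))%E.
Proof.
have [e1 [e2 [l1 [c [l2 sf]]]]] := ex_schur dot dimV A.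
have [-> _ ->] := invariants_schur dimV sf.
have hre := has_real_eigenvalue_schur sf.
have cE := conformal_range_shell dimV sf.
have c0 : 0 <= sqc c by rewrite addr_ge0 ?sqr_ge0.
have [bb|bb] := eqVneq (complex.Im l1 * complex.Im l2) 0.
  have re : has_real_eigenvalue A by apply/hre.
  have := shell_asymptotic (complex.Re l1) (complex.Im l1) (complex.Re l2)
    (complex.Im l2) c0.
  rewrite -cE => ap; rewrite bb normr0 /equot eqxx.
  have [K0|K0] := eqVneq ((complex.Im l1 ^+ 2 + complex.Im l2 ^+ 2
      + (complex.Re l1 - complex.Re l2) ^+ 2 + sqc c) / 2) 0.
    have pa : range_is_asymptotic_point dot A by apply/ap; lra.
    rewrite /= arcosh1 mule0; split=> [|->]; last exact: MajorAsymptoticPoint.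
    by case=> // s nre; case: nre.
  have npa : ~ range_is_asymptotic_point dot A.
    by move/ap => h; rewrite h mul0r eqxx in K0.
  rewrite /= gt0_muley ?lte_fin ?invr_gt0 //; split=> [|->]; last exact: MajorAsymptotic.
  by case=> // s nre; case: nre.
have nre : ~ has_real_eigenvalue A by move/hre/eqP; rewrite (negbTE bb).
have [b1 b2] : complex.Im l1 != 0 /\ complex.Im l2 != 0.
  by move: bb; rewrite mulf_eq0 negb_or => /andP[].
have [sE hs] := @shell_hellipse R (complex.Re l1) _ (complex.Re l2) _ _ _ b1 b2 c0 (erefl _).
rewrite /equot normr_eq0 (negbTE bb) normrM /= -EFinM mulrC.
set s := arcosh _ / 2 in sE hs *.
have os : ordinary_semimajor (conformal_range dot A) s.
  by rewrite cE sE; apply: ordinary_semimajor_hellipse => //; exact: ordinary_focus.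
split=> [|->]; last exact: MajorOrdinary.
by case=> // t _ /(ordinary_semimajor_unique os) ->.
Qed.

Lemma focal_distanceE A y : focal_distance dot A y <->
  y = earcosh (equot (E_ A + cabs (D_ A)) `|E_ A - cabs (D_ A)|).
Proof.
have [e1 [e2 [l1 [c [l2 sf]]]]] := ex_schur dot dimV A.
have [-> -> _] := invariants_schur dimV sf.
have hre := has_real_eigenvalue_schur sf.
have lE := leigenvalue_schur sf.
have cE := conformal_range_shell dimV sf.
have [_ cp] := schur_trig dimV sf.
have c0 : 0 <= sqc c by rewrite addr_ge0 ?sqr_ge0.
have double (l : R) : char_poly (opmx A) = ('X - (l%:C)%:P) ^+ 2 ->
    l1 = l%:C /\ l2 = l%:C.
  rewrite cp => h.
  have r1 : root (('X - (l%:C)%:P) ^+ 2) l1 by rewrite -h rootM root_XsubC eqxx.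
  have r2 : root (('X - (l%:C)%:P) ^+ 2) l2 by rewrite -h rootM !root_XsubC eqxx orbT.
  by move: r1 r2; rewrite expr2 !rootM !root_XsubC !orbb => /eqP -> /eqP ->.
have [bb|bb] := eqVneq (complex.Im l1 * complex.Im l2) 0.
  have re : has_real_eigenvalue A by apply/hre.
  rewrite bb normr0 /equot eqxx.
  have [K0|K0] := eqVneq ((complex.Im l1 ^+ 2 + complex.Im l2 ^+ 2
      + (complex.Re l1 - complex.Re l2) ^+ 2) / 2) 0.
    have [l Hl1 Hl2] : exists2 l : R, l1 = l%:C & l2 = l%:C.
      have := sqr_ge0 (complex.Im l1); have := sqr_ge0 (complex.Im l2).
      have := sqr_ge0 (complex.Re l1 - complex.Re l2) => h3 h2 h1.
      have [/eqP q1 /eqP q2 /eqP q3] : [/\ complex.Im l1 ^+ 2 = 0,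
        complex.Im l2 ^+ 2 = 0 & (complex.Re l1 - complex.Re l2) ^+ 2 = 0].
        by split; lra.
      move: q1 q2 q3; rewrite !sqrf_eq0 subr_eq0.
      case: (l1) (l2) => x1 y1 [x2 y2] /= /eqP -> /eqP -> /eqP ->.
      by exists x2.
    rewrite /= arcosh1; split=> [|->].
      case=> [F1 F2 m nre|l' mu|//]; first by case: nre.
      rewrite !lE Hl1 Hl2 !orbb => /eqP -> /eqP ->; by rewrite eqxx.
    by apply: (@FocalDouble _ _ dot A l); rewrite cp Hl1 Hl2 expr2.
  rewrite /=; split=> [|->].
    case=> [F1 F2 m nre|//|l /double [Hl1 Hl2]]; first by case: nre.
    by move: K0; rewrite Hl1 Hl2 /= subrr expr0n /= !addr0 mul0r eqxx.
  have l12 : l1 != l2.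
    apply: contra K0 => /eqP l12; move: bb; rewrite l12 => /eqP.
    by rewrite mulf_eq0 orbb => /eqP ->; rewrite subrr expr0n /= !addr0 mul0r.
  move/eqP: bb; rewrite mulf_eq0 => /orP[] /eqP /real_complex_eq [l h].
    apply: (@FocalDistinct _ _ dot A l l2); rewrite ?lE ?h ?eqxx ?orbT //.
    by rewrite eq_sym.
  by apply: (@FocalDistinct _ _ dot A l l1); rewrite ?lE ?h ?eqxx ?orbT.
have nre : ~ has_real_eigenvalue A by move/hre/eqP; rewrite (negbTE bb).
have [b1 b2] : complex.Im l1 != 0 /\ complex.Im l2 != 0.
  by move: bb; rewrite mulf_eq0 negb_or => /andP[].
have [sE hs] := @shell_hellipse R (complex.Re l1) _ (complex.Re l2) _ _ _ b1 b2 c0 (erefl _).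
have fo1 := ordinary_focus (complex.Re l1) b1.
have fo2 := ordinary_focus (complex.Re l2) b2.
rewrite /equot normr_eq0 (negbTE bb) normrM /= -hd_focus // -hdistE //.
rewrite -cE in sE; split=> [|->].
  case=> [F1 F2 m _ of1 of2 hm rE|l mu El|l /double [Hl1 Hl2]].
  - rewrite !hdistE // lee_fin in hm *; congr EFin.
    by apply: (focal_distance_unique _ _ _ _ hm hs); rewrite -?sE -?rE.
  - by case: nre; exists l.
  - by case: nre; exists l; rewrite lE Hl1 eqxx.
apply: (@FocalOrdinary _ _ dot A _ _ _ nre fo1 fo2 _ sE).
by rewrite hdistE // lee_fin.
Qed.

End Main.

Theorem theorem2p7 (R : realType) (V : vectType R[i])
    (dot : {dot V for Num.conj}) (dimV : \dim {:V} = 2%N) (A : 'End(V)) :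
  (forall s : \bar R, major_semiaxis dot A s <->
     s = ((2^-1)%:E * earcosh (equot (U_ dot A + E_ A)%R
                                     `|E_ A - cabs (D_ A)|%R))%E) /\
  (forall sf : \bar R, focal_distance dot A (2%:E * sf)%E <->
     sf = ((2^-1)%:E * earcosh (equot (E_ A + cabs (D_ A))%R
                                      `|E_ A - cabs (D_ A)|%R))%E).
Proof.
split=> s; first exact: major_semiaxisE.
split=> [/(focal_distanceE dot dimV) <-|->].
  by rewrite muleA -EFinM mulVf ?mul1e.
by apply/(focal_distanceE dot dimV); rewrite muleA -EFinM mulfV ?mul1e.
Qed.
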